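(* Let $q$ be an odd prime power. The groups $G$ and $G'$ have the same point-orbits on $\mathrm{PG}(3,q^2)$, and there are exactly $q+4$ of them: (i) $\mathcal{O}$; (ii) $\Sigma\setminus\mathcal{O}$; (iii) $\mathcal{Q}^+(3,q^2)\setminus\mathcal{O}$; (iv) the two orbits $\mathcal{H}_1,\mathcal{H}_2$ on points of $\mathcal{H}(3,q^2)\setminus\mathcal{O}$; (v) $\tilde{\mathcal{S}}_j$, $j\in\{1,\dots,(q-1)/2\}$; (vi) $\tilde{\mathcal{E}}_k$, $k\in\{1,\dots,(q-3)/2\}$; (vii) $\tilde{\mathcal{E}}_0$.
   Context: $q$ is an odd prime power and $\xi$ is a fixed primitive element of $\mathbb{F}_{q^2}$. $\mathrm{PG}(3,q^2)$ has homogeneous coordinates $(X_1,X_2,X_3,X_4)$. $\mathcal{H}(3,q^2)$: $X_1^qX_4+X_1X_4^q-X_2^{q+1}-X_3^{q+1}=0$. $\mathcal{Q}^+(3,q^2)$: $X_1X_4-X_2X_3=0$. $\mathcal{O}=\{(1,t,t^q,t^{q+1}) : t\in\mathbb{F}_{q^2}\}\cup\{(0,0,0,1)\}$. $\Sigma=\{(a,b,b^q,c): a,c\in\mathbb{F}_q,\ b\in\mathbb{F}_{q^2}\}$, a Baer subgeometry of $\mathrm{PG}(3,q^2)$. $G\cong\mathrm{PGL}(2,q^2)$ is the group of projectivities of $\mathrm{PG}(3,q^2)$ induced (on column vectors) by the Kronecker products $A^q\otimes A$, $A\in\mathrm{GL}(2,q^2)$, where $A^q$ is $A$ with all entries raised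 to the $q$-th power; it is the $\mathbb{F}_{q^2}$-rational automorphism group of the curve $\{(1,t,t^q,t^{q+1}): t\in\overline{\mathbb{F}}_{q^2}\}\cup\{(0,0,0,1)\}$. $G'=G\rtimes\langle\iota\rangle$, where $\iota:(X_1,X_2,X_3,X_4)\mapsto(X_1,X_3,X_2,X_4)$; it is the group of all projectivities of $\mathrm{PG}(3,q^2)$ stabilizing $\mathcal{O}$. $K\leq G$ is the subgroup induced by $A^q\otimes A$ with $A\in\mathrm{SL}(2,q^2)$; $K$ has exactly two orbits on the points of $\mathcal{H}(3,q^2)\setminus\mathcal{O}$, $\mathcal{H}_1$ of size $q^2(q^2+1)(q-1)/2$ and $\mathcal{H}_2$ of size $q^2(q^2+1)(q+1)/2$. For $\gamma\in\mathbb{F}_{q^2}$ let $F_\gamma=X_1^q X_4 + X_1 X_4^q - X_2^{q+1} - X_3^{q+1} - \gamma (X_1 X_4 - X_2 X_3)^{\frac{q+1}{2}}$. For $j\in\{1,\dots,q\}\setminus\{(q+1)/2\}$, $\mathcal{S}_j$ is the set of points with $F_\gamma=0$, $\gamma=\xi^{j\frac{q-1}{2}}+\xi^{-j\frac{q-1}{2}}$; for $k\in\{0,\dots,q-1\}\setminus\{(q-1)/2\}$, $\mathcal{E}_k$ is the set of points with $F_\gamma=0$, $\gamma=\xi^{k\frac{q+1}{2}}+\xi^{-k\frac{q+1}{2}}$. Set $\tilde{\mathcal{S}}_j=(\mathcal{S}_j\cup\mathcal{S}_{q+1-j})\setminus\mathcal{O}$ for $j\in\{1,\dots,(q-1)/2\}$,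 $\tilde{\mathcal{E}}_k=(\mathcal{E}_k\cup\mathcal{E}_{q-1-k})\setminus\mathcal{O}$ for $k\in\{1,\dots,(q-3)/2\}$, and $\tilde{\mathcal{E}}_0=(\mathcal{E}_0\cup\mathcal{E}_{q-1})\setminus\Sigma$. *)

(* Defs.v *)
From HB Require Import structures.
From mathcomp Require Import all_boot all_order all_algebra all_fingroup.
From mathcomp Require Import all_solvable all_field.
From mathcomp.real_closed Require Export mxtens.

Set Implicit Arguments.
Unset Strict Implicit.
Unset Printing Implicit Defensive.

Import GroupScope GRing.Theory.
Local Open Scope ring_scope.

Definition line (F : finFieldType) (v : 'cV[F]_4) : {set 'cV[F]_4} :=
  [set c *: v | c : F].

Definition is_point (F : finFieldType) (L : {set 'cV[F]_4}) : bool :=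
  [exists v : 'cV[F]_4, (v != 0) && (L == line v)].

Record PG3 (F : finFieldType) : Type := Point {
  point_set :> {set 'cV[F]_4};
  _ : is_point point_set }.
HB.instance Definition _ (F : finFieldType) := [isSub for @point_set F].
HB.instance Definition _ (F : finFieldType) := [Finite of PG3 F by <:].

(* The set of points that have a coordinate vector satisfying P. *)
Definition points_of (F : finFieldType) (P : pred 'cV[F]_4) : {set PG3 F} :=
  [set p : PG3 F | [exists v in point_set p, (v != 0) && P v]].

Lemma line_mulmx (F : finFieldType) (M : 'M[F]_4) (v : 'cV[F]_4) :
  [set M *m w | w in line v] = line (M *m v).
Proof.
apply/setP=> x; apply/imsetP/imsetP => [[w /imsetP[c _ ->] ->]|[c _ ->]].
  by exists c; rewrite // scalemxAr.
exists (c *: v); last by rewrite scalemxAr.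
by apply/imsetP; exists c.
Qed.

Lemma unitmx_mul_inj (F : finFieldType) (g : {'GL_4[F]}) :
  injective (fun v : 'cV[F]_4 => GLval g *m v).
Proof.
apply: (can_inj (g := mulmx (invmx (GLval g)))) => v.
by rewrite mulKmx ?GL_unitmx.
Qed.

Lemma is_point_mulmx (F : finFieldType) (g : {'GL_4[F]}) (p : PG3 F) :
  is_point [set GLval g *m v | v in point_set p].
Proof.
have /existsP[v /andP[v0 /eqP->]] := valP p.
apply/existsP; exists (GLval g *m v); rewrite line_mulmx eqxx andbT.
apply: contraNneq v0 => h.
by apply/eqP/(@unitmx_mul_inj _ g); rewrite /= h mulmx0.
Qed.

Definition proj_fun (F : finFieldType) (g : {'GL_4[F]}) (p : PG3 F) : PG3 F :=
  Point (is_point_mulmx g p).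

Lemma proj_fun_inj (F : finFieldType) (g : {'GL_4[F]}) :
  injective (proj_fun g).
Proof.
move=> p1 p2 /(congr1 val) /= e.
by apply/val_inj/(imset_inj (@unitmx_mul_inj _ g)).
Qed.

(* Composition of permutations is in diagrammatic order, so this is an        *)
(* anti-morphism; images of subgroups of GL_4 are subgroups all the same.     *)
Definition projectivity (F : finFieldType) (g : {'GL_4[F]}) : {perm PG3 F} :=
  perm (@proj_fun_inj F g).

(* The entrywise q-th power of A. *)
Definition frob_mx (q : nat) (F : finFieldType) (A : 'M[F]_2) : 'M[F]_2 :=
  map_mx (fun x => x ^+ q) A.

(* A set, because it is a group only when x |-> x ^+ q is a field             *)
(* automorphism: see group_set_grpG.                                          *)
Definition grpG (q : nat) (F : finFieldType) : {set {perm PG3 F}} :=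
  [set projectivity g | g : {'GL_4[F]} &
    [exists A : 'M[F]_2, (A \in unitmx) && (GLval g == frob_mx q A *t A)]].

Definition grpK (q : nat) (F : finFieldType) : {set {perm PG3 F}} :=
  [set projectivity g | g : {'GL_4[F]} &
    [exists A : 'M[F]_2, (\det A == 1) && (GLval g == frob_mx q A *t A)]].

(* In 'I_4 the ring numerals 0, 1, 2, 3 are the indices of the homogeneous    *)
(* coordinates X_1, X_2, X_3, X_4.                                            *)
Lemma swap_unit (F : finFieldType) :
  (tperm_mx 1 2%:R : 'M[F]_4) \is a GRing.unit.
Proof. exact: unitmx_perm. Qed.

Definition iota_proj (F : finFieldType) : {perm PG3 F} :=
  projectivity (FinRing.unit 'M[F]_4 (swap_unit F)).

(* The internal semidirect product; it would be empty if the product were not *)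
(* semidirect, which sdprod_grpG' excludes.                                   *)
Definition grpG' (q : nat) (F : finFieldType) : {set {perm PG3 F}} :=
  (grpG q F ><| <[iota_proj F]>)%g.

Definition vec4 (F : finFieldType) (a b c d : F) : 'cV[F]_4 :=
  \col_i [:: a; b; c; d]`_i.

Definition hermf (q : nat) (F : finFieldType) (v : 'cV[F]_4) : F :=
  v 0 0 ^+ q * v 3%:R 0 + v 0 0 * v 3%:R 0 ^+ q
  - v 1 0 ^+ q.+1 - v 2%:R 0 ^+ q.+1.

Definition quadf (F : finFieldType) (v : 'cV[F]_4) : F :=
  v 0 0 * v 3%:R 0 - v 1 0 * v 2%:R 0.

Definition calH (q : nat) (F : finFieldType) : {set PG3 F} :=
  points_of (fun v => hermf q v == 0).

Definition calQ (F : finFieldType) : {set PG3 F} :=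
  points_of (fun v => quadf v == 0).

Definition calO (q : nat) (F : finFieldType) : {set PG3 F} :=
  points_of (fun v =>
    [exists t, v == vec4 1 t (t ^+ q) (t ^+ q.+1)] || (v == vec4 0 0 0 1)).

(* F_q is the set of roots of x ^+ q = x in F. *)
Definition Sigma (q : nat) (F : finFieldType) : {set PG3 F} :=
  points_of (fun v => [exists a, exists b, exists c,
    [&& a ^+ q == a, c ^+ q == c & v == vec4 a b (b ^+ q) c]]).

(* The equation is homogeneous of degree q + 1, hence well defined on points. *)
Definition V_gamma (q : nat) (F : finFieldType) (gamma : F) : {set PG3 F} :=
  points_of (fun v => hermf q v - gamma * quadf v ^+ q.+1./2 == 0).

Definition calS (q : nat) (F : finFieldType) (xi : F) (j : nat) :
    {set PG3 F} :=
  V_gamma q (xi ^+ (j * q.-1./2) + xi ^- (j * q.-1./2)).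

Definition calE (q : nat) (F : finFieldType) (xi : F) (k : nat) :
    {set PG3 F} :=
  V_gamma q (xi ^+ (k * q.+1./2) + xi ^- (k * q.+1./2)).

Definition calSt (q : nat) (F : finFieldType) (xi : F) (j : nat) :
    {set PG3 F} :=
  (calS q xi j :|: calS q xi (q.+1 - j)) :\: calO q F.

(* Used for k > 0 only: the case k = 0 is calEt0, where Sigma is removed.     *)
Definition calEt (q : nat) (F : finFieldType) (xi : F) (k : nat) :
    {set PG3 F} :=
  (calE q xi k :|: calE q xi (q.-1 - k)) :\: calO q F.

Definition calEt0 (q : nat) (F : finFieldType) (xi : F) : {set PG3 F} :=
  (calE q xi 0 :|: calE q xi q.-1) :\: Sigma q F.

(* The point-orbits of a set A of permutations (in practice a group) on X. *)
Definition orbits (F : finFieldType) (A : {set {perm PG3 F}})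
    (X : {set PG3 F}) : {set {set PG3 F}} :=
  [set orbit 'P A p | p in X].

Lemma projectivityE (F : finFieldType) (g : {'GL_4[F]}) (p : PG3 F) :
  point_set (projectivity g p) = [set GLval g *m v | v in point_set p].
Proof. by rewrite permE. Qed.

Lemma projectivityM (F : finFieldType) (g h : {'GL_4[F]}) :
  projectivity (g * h)%g = (projectivity h * projectivity g)%g.
Proof.
apply/permP=> p; apply: val_inj; rewrite permM /= !projectivityE -imset_comp.
by apply: eq_imset => v /=; rewrite mulmxA.
Qed.

Lemma tens1mx1 (F : finFieldType) :
  (1%:M : 'M[F]_2) *t (1%:M : 'M[F]_2) = 1%:M.
Proof.
apply/matrixP=> i j; case: (mxtens_indexP i) => i0 i1.
case: (mxtens_indexP j) => j0 j1; rewrite tensmxE !mxE.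
rewrite (inj_eq (can_inj (@mxtens_indexK 2 2))) xpair_eqE /=.
by case: (i0 == j0); case: (i1 == j1); rewrite /= ?mulr1 ?mulr0.
Qed.

Lemma swap2 (F : finFieldType) :
  (tperm_mx 1 2%:R : 'M[F]_4) *m tperm_mx 1 2%:R = 1%:M.
Proof. by rewrite /tperm_mx -perm_mxM tperm2 perm_mx1. Qed.

Lemma swap_tens (F : finFieldType) (A B : 'M[F]_2) :
  (tperm_mx 1 2%:R : 'M[F]_4) *m (A *t B) = (B *t A) *m tperm_mx 1 2%:R.
Proof.
have sw (i j : 'I_2) : tperm 1 2%:R (mxtens_index (i, j)) = mxtens_index (j, i).
  apply: val_inj; rewrite permE /=.
  by case: i => [[|[|i]] // ?]; case: j => [[|[|j]] // ?].
rewrite /tperm_mx -row_permE -[X in _ *m perm_mx X]tpermV -col_permE.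
apply/matrixP=> i j; case: (@mxtens_indexP 2 2 i) => i0 i1.
case: (@mxtens_indexP 2 2 j) => j0 j1; rewrite !mxE.
by rewrite !sw !mxtens_indexK /= mulrC.
Qed.

Section GroupG.
Variables (p e q : nat) (F : finFieldType).
Hypotheses (p_prime : prime p) (q_def : q = (p ^ e)%N).
Hypothesis cardF : #|F| = (q ^ 2)%N.

Lemma expfD_q (x y : F) : (x + y) ^+ q = x ^+ q + y ^+ q.
Proof.
have e2 : #|F| = (p ^ (e * 2))%N by rewrite expnM -q_def.
have pF : p \in [pchar F] by apply: (card_finPcharP e2).
apply: exprDn_pchar; rewrite q_def pnatX; apply/orP; left.
by rewrite (eq_pnat _ (pcharf_eq pF)) pnat_id.
Qed.

Lemma q_gt0 : (0 < q)%N. Proof. by rewrite q_def expn_gt0 prime_gt0. Qed.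

Lemma expf_qq (x : F) : (x ^+ q) ^+ q = x.
Proof. by rewrite -exprM mulnn -cardF expf_card. Qed.

Lemma frob_mxM (A B : 'M[F]_2) :
  frob_mx q (A *m B) = frob_mx q A *m frob_mx q B.
Proof.
apply/matrixP=> i j; rewrite !mxE !big_ord_recl !big_ord0 !addr0 expfD_q.
by rewrite !exprMn !mxE.
Qed.

Lemma frob_mx1 : frob_mx q (1%:M : 'M[F]_2) = 1%:M.
Proof.
apply/matrixP=> i j; rewrite !mxE; case: (i == j); rewrite ?expr1n //.
by rewrite expr0n gtn_eqF // q_gt0.
Qed.

Lemma frob_mxK (A : 'M[F]_2) : frob_mx q (frob_mx q A) = A.
Proof. by apply/matrixP=> i j; rewrite !mxE expf_qq. Qed.

Lemma group_set_grpG : group_set (grpG q F).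
Proof.
apply/group_setP; split.
  apply/imsetP; exists 1%g; last first.
    apply/permP=> x; apply: val_inj; rewrite perm1 /= projectivityE.
    by rewrite (eq_imset _ (g := id)) ?imset_id // => v; rewrite mul1mx.
  rewrite inE; apply/existsP; exists 1%:M; rewrite unitmx1 frob_mx1 /=.
  exact/eqP/esym/tens1mx1.
move=> x y /imsetP[g /[!inE]/existsP[A /andP[uA /eqP gA]] ->].
move=> /imsetP[h /[!inE]/existsP[B /andP[uB /eqP hB]] ->].
rewrite -projectivityM; apply: imset_f; rewrite inE; apply/existsP.
exists (B *m A); rewrite unitmx_mul uA uB frob_mxM -tensmx_mul -gA -hB /=.
by [].
Qed.

Lemma iota_proj2 : (iota_proj F * iota_proj F = 1)%g.
Proof.
rewrite -projectivityM; apply/permP=> x; apply: val_inj.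
rewrite perm1 /= projectivityE (eq_imset _ (g := id)) ?imset_id // => v /=.
by rewrite [X in X *m v]swap2 mul1mx.
Qed.

Lemma iota_proj_norm : <[iota_proj F]> \subset 'N(grpG q F).
Proof.
rewrite cycle_subG inE; apply/subsetP=> x; rewrite mem_conjg => sG.
have iV : (iota_proj F)^-1%g = iota_proj F.
  by apply: (mulgI (iota_proj F)); rewrite mulgV iota_proj2.
move: sG; rewrite iV => /imsetP[g /[!inE]/existsP[A /andP[uA /eqP gA]] sg].
have -> : x = (projectivity g ^ iota_proj F)%g.
  by rewrite -sg -conjgM iota_proj2 conjg1.
rewrite conjgE iV -!projectivityM; apply: imset_f; rewrite inE.
apply/existsP; exists (frob_mx q A); apply/andP; split.
  have /(congr1 (@frob_mx q F)) := mulmxV uA.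
  by rewrite frob_mxM frob_mx1 => /mulmx1_unit[].
rewrite frob_mxK; apply/eqP.
transitivity (tperm_mx 1 2%:R *m GLval g *m tperm_mx 1 2%:R) => //.
rewrite gA.
by rewrite swap_tens -mulmxA swap2 mulmx1.
Qed.

Lemma iota_proj_notin : iota_proj F \notin grpG q F.
Proof.
apply/negP => /imsetP[g /[!inE]/existsP[A /andP[uA /eqP gA]] eg].
have cE (i : 'I_4) : exists c, GLval g *m delta_mx i (0 : 'I_1) =
    c *: delta_mx (tperm 1 2%:R i) 0.
  have d0 : delta_mx i 0 != 0 :> 'cV[F]_4.
    apply/eqP=> /matrixP/(_ i 0)/eqP.
    by rewrite !mxE !eqxx /= oner_eq0.
  have ip : is_point (line (delta_mx i (0 : 'I_1) : 'cV[F]_4)).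
    by apply/existsP; exists (delta_mx i 0); rewrite d0 eqxx.
  have /(congr1 (fun s : {perm PG3 F} => point_set (s (Point ip)))) := esym eg.
  rewrite !projectivityE /= !line_mulmx => /setP/(_ (GLval g *m delta_mx i 0)).
  have -> : tperm_mx 1 2%:R *m delta_mx i 0 =
      delta_mx (tperm 1 2%:R i) 0 :> 'cV[F]_4.
    apply/matrixP=> k l; rewrite -row_permE !mxE; congr ((_ && _)%:R).
    by rewrite (canF_eq (@tpermK _ 1 2%:R)).
  have -> : GLval g *m delta_mx i 0 \in line (GLval g *m delta_mx i 0).
    by apply/imsetP; exists 1; rewrite ?scale1r.
  by move=> /esym/imsetP[c _ ->]; exists c.
have gE (i j i' j' : 'I_2) :
    GLval g (mxtens_index (i, j)) (mxtens_index (i', j'))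
    = A i i' ^+ q * A j j'.
  transitivity ((frob_mx q A *t A) (mxtens_index (i, j))
    (mxtens_index (i', j'))); first by rewrite gA.
  by rewrite tensmxE mxE.
have gcol (i j : 'I_4) : tperm 1 2%:R j != i -> GLval g i j = 0.
  move=> ne; have [c /matrixP/(_ i 0)] := cE j.
  by rewrite -colE !mxE (eq_sym i) (negPf ne) mulr0.
have q0 := q_gt0.
have A10 : A 1 0 = 0.
  have /eqP := gE 1 1 0 0; rewrite gcol; last by rewrite permE.
  by rewrite eq_sym mulf_eq0 expf_eq0 q0 orbb => /eqP.
have A00 : A 0 0 * A 1 1 = 0.
  have /eqP := gE 0 1 0 1; rewrite gcol; last by rewrite permE.
  by rewrite eq_sym mulf_eq0 expf_eq0 q0 -mulf_eq0 => /eqP.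
have Atrig : is_trig_mx A^T.
  apply/is_trig_mxP=> i j; rewrite mxE.
  case: i j => [[|[|i]] // ?] [[|[|j]] // ?] // _.
  by rewrite -[RHS]A10; congr (A _ _); apply: val_inj.
have detA : \det A = A 0 0 * A 1 1.
  rewrite -det_tr det_trig // !big_ord_recl big_ord0 mulr1 !mxE.
  by congr (_ * A _ _); apply: val_inj.
by move: uA; rewrite unitmxE detA A00 unitr0.
Qed.

Lemma sdprod_grpG' : group_set (grpG' q F) /\
  grpG' q F = (grpG q F * <[iota_proj F]>)%g.
Proof.
pose G := Group group_set_grpG.
have nG : <[iota_proj F]> \subset 'N(G) by exact: iota_proj_norm.
have i2 : #[iota_proj F] = 2%N.
  apply/nt_prime_order => //; first by rewrite expg2 // iota_proj2.
  apply: contraNneq iota_proj_notin => ->; exact: (group1 G).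
have ti : G :&: <[iota_proj F]> = 1%g.
  rewrite setIC; apply: prime_TIg; first by rewrite -orderE i2.
  by rewrite cycle_subG; exact: iota_proj_notin.
have E : grpG' q F = (G * <[iota_proj F]>)%g by exact: sdprodE nG ti.
by split=> //; rewrite E -norm_joinEr ?groupP.
Qed.

End GroupG.

(* Main.v *)
(* A vector (X1, X2, X3, X4) is read as the sesquilinear form with matrix      *)
(* M = [[X1, X2], [X3, X4]]; then [A^q (x) A] acts by M |-> A^q M A^T,         *)
(* [quadf] is d = det M, and [hermf] is h, the polarisation of det at M and    *)
(* its conjugate transpose M^*. Both are multiplied by the norm of det A, so   *)
(* s = h^2 / (d d^q) is an invariant of the points off the quadric, and        *)
(* s = gamma^2 on F_gamma = 0. The discriminant of the characteristic          *)
(* polynomial of the cosquare M^* M^-1 is a square, so the cosquare has an     *)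
(* eigenvector; completing it to a basis brings M to diag(1, b),               *)
(* antidiag(1, c) or [[0, 1], [1, eps]] with eps^q = - eps. The first two are  *)
(* determined up to equivalence by s, they have common values of s only for    *)
(* s = 0 (where the quadratic character of d separates them) and s = 4 (where  *)
(* they are Hermitian up to a scalar, hence equivalent), and the third has     *)
(* s = 4. Orbit sizes under K come from the stabilisers in SL_2.               *)

Require Import Defs.
From HB Require Import structures.
From mathcomp Require Import all_boot all_order all_algebra all_fingroup all_field.
From mathcomp Require Import ring zify.
Set Implicit Arguments.
Unset Strict Implicit.
Unset Printing Implicit Defensive.
Import GroupScope GRing.Theory.
Local Open Scope ring_scope.

(** [G] acts on points as change of basis acts on sesquilinear forms of a plane, taken up to a
    scalar, so its orbits are found by classifying such forms. Three facts on F_{q^2} over F_q do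
    the arithmetic: the norm is onto F_q ([norm_surj]), elements of norm 1 are quotients [cj y / y]
    ([hilbert90]), and elements of F_q are squares in F_{q^2} ([fix_sqr]). [norm_form] lists the
    normal forms off the quadric; [calO_eqv] and [calQ_eqv] treat the quadric. [label] is a complete
    invariant: it is constant on orbits by [label_eqv] and separates them by [labelP].

    The invariant s takes every value of F_q; the values 0 and 4 carry two orbits each, and the
    quadric two more, whence the count ([label_in], [label_onto], [card_labels]). The involution
    iota transposes the matrix, which preserves the label ([label_swap]), so [G'] fuses no orbits.

    Since s = gamma^2 on F_gamma = 0, the pair gamma, -gamma cuts out one value of s off the
    quadric. Writing s = u + 2 + u^-1, the elements of F_q other than 0 and 4 are those with u^2 !=
    1 and u^(q+1) = 1 or u^(q-1) = 1 ([gamma_ex]): the first kind gives the S_j, the second the E_k.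

    Each [G]-orbit on the Hermitian surface outside O stays one orbit under [K], because its
    representative is fixed by a matrix of nonsquare determinant ([base_stab], [act_SL], [orbitK]).
    The stabilisers in SL_2 are diagonal, of orders 2(q + 1) and 2(q - 1), which yields the
    sizes. *)

Definition conjf (q : nat) (F : finFieldType) (x : F) : F := x ^+ q.

Definition kron_act (q : nat) (F : finFieldType) (A : 'M[F]_2) (v : 'cV[F]_4) :
    'cV[F]_4 := (frob_mx q A *t A) *m v.

Definition sesq_form (q : nat) (F : finFieldType) (v : 'cV[F]_4) (a b c d : F) : F :=
  conjf q a * (v 0 0 * c + v 1 0 * d) + conjf q b * (v 2%:R 0 * c + v 3%:R 0 * d).

Definition mx2 (F : finFieldType) (a b c d : F) : 'M[F]_2 :=
  \matrix_(i, j) (nth [::] [:: [:: a; b]; [:: c; d]] i)`_j.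

Lemma vec4_eta (F : finFieldType) (v : 'cV[F]_4) :
  v = vec4 (v 0 0) (v 1 0) (v 2%:R 0) (v 3%:R 0).
Proof.
apply/matrixP=> i j; rewrite ord1 !mxE.
by case: i => [[|[|[|[|i]]]] // ?] /=; congr (v _ _); apply: val_inj.
Qed.

Lemma mx2_eta (F : finFieldType) (A : 'M[F]_2) :
  A = mx2 (A 0 0) (A 0 1) (A 1 0) (A 1 1).
Proof.
apply/matrixP=> i j; rewrite !mxE.
by case: i => [[|[|i]] // ?]; case: j => [[|[|j]] // ?] /=;
  congr (A _ _); apply: val_inj.
Qed.

Lemma mulmx2 (F : finFieldType) (a b c d a' b' c' d' : F) :
  mx2 a b c d *m mx2 a' b' c' d'
  = mx2 (a * a' + b * c') (a * b' + b * d') (c * a' + d * c') (c * b' + d * d').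
Proof.
apply/matrixP=> i j; rewrite !mxE !big_ord_recl big_ord0 addr0 !mxE /=.
by case: i => [[|[|i]] // ?]; case: j => [[|[|j]] // ?].
Qed.

Lemma det_mx2 (F : finFieldType) (a b c d : F) :
  \det (mx2 a b c d) = a * d - b * c.
Proof.
rewrite (expand_det_row _ 0) !big_ord_recl big_ord0 addr0 /cofactor !det_mx11.
by rewrite !mxE /= expr0 mul1r expr1 mulN1r mulrN.
Qed.

(** The rows of the matrix form a new basis, and the new coordinates are the Gram matrix of the form
    in that basis. *)
Lemma actE (q : nat) (F : finFieldType) (a b c d : F) (v : 'cV[F]_4) :
  kron_act q (mx2 a b c d) v = vec4 (sesq_form q v a b a b) (sesq_form q v a b c d)
                               (sesq_form q v c d a b) (sesq_form q v c d c d).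
Proof.
apply/matrixP=> i j; rewrite ord1 !mxE !big_ord_recl big_ord0 addr0 !mxE /=.
have -> : lift ord0 ord0 = 1 :> 'I_4 by apply: val_inj.
have -> : lift ord0 (lift ord0 ord0) = 2%:R :> 'I_4 by apply: val_inj.
have -> : lift ord0 (lift ord0 (lift ord0 ord0)) = 3%:R :> 'I_4 by apply: val_inj.
case: i => [[|[|[|[|i]]]] // ?]; rewrite /sesq_form /conjf /=; ring.
Qed.

(** * The field with q^2 elements and its conjugation *)

Section Orbits.
Variables (p e q : nat) (F : finFieldType) (xi : F).
Hypotheses (p_prime : prime p) (e_gt0 : (0 < e)%N) (q_def : q = (p ^ e)%N).
Hypotheses (q_odd : odd q) (cardF : #|F| = (q ^ 2)%N).
Hypothesis xi_prim : (q ^ 2).-1.-primitive_root xi.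
Local Notation cj := (@conjf q F).

Lemma q_gt2 : (2 < q)%N.
Proof.
have := prime_gt1 p_prime; have := q_odd.
rewrite q_def; case: e e_gt0 => // n _ o p1.
have : (p ^ 1 <= p ^ n.+1)%N by rewrite leq_exp2l.
by rewrite expn1; case: (p ^ n.+1)%N o => [|[|[|m]]] //; lia.
Qed.

Lemma sqq1 : (q ^ 2).-1 = (q.+1 * q.-1)%N.
Proof. by have := q_gt2; case: q => // n _; rewrite /= mulnC; lia. Qed.

Lemma cjD (x y : F) : cj (x + y) = cj x + cj y.
Proof. exact: expfD_q p_prime q_def cardF x y. Qed.
Lemma cjM (x y : F) : cj (x * y) = cj x * cj y.
Proof. exact: exprMn. Qed.
Lemma cjK x : cj (cj x) = x.
Proof. exact: expf_qq cardF x. Qed.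
Lemma cj1 : cj 1 = 1. Proof. exact: expr1n. Qed.
Lemma cj0 : cj 0 = 0.
Proof. by rewrite /conjf expr0n; case: (q) (q_gt2). Qed.
Lemma cjN x : cj (- x) = - cj x.
Proof. by apply/eqP; rewrite -subr_eq0 opprK -cjD addNr cj0. Qed.
Lemma cjV x : cj x^-1 = (cj x)^-1. Proof. exact: exprVn. Qed.
Lemma cjX x n : cj (x ^+ n) = cj x ^+ n. Proof. exact: exprAC. Qed.
Lemma cjn n : cj n%:R = n%:R.
Proof. by elim: n => [|n IH]; rewrite ?cj0 // -!natr1 cjD IH cj1. Qed.
Definition cjE := (cjD, cjM, cjK, cj1, cj0, cjN, cjV, cjX, cjn).

Lemma cj_eq0 (x : F) : (cj x == 0) = (x == 0).
Proof. by rewrite expf_eq0; case: (q) (q_gt2). Qed.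

Lemma two_neq0 : 2%:R != 0 :> F.
Proof.
have e2 : #|F| = (p ^ (e * 2))%N by rewrite expnM -q_def.
have pF : p \in [pchar F] by apply: (card_finPcharP e2).
apply/negP => h; have := pcharf_eq pF 2.
rewrite !inE h => /esym/eqP p2.
by move: q_odd; rewrite q_def -p2 oddX; case: e e_gt0.
Qed.

Lemma xi_pow (x : F) : x != 0 -> exists i : nat, x = xi ^+ i.
Proof.
move=> x0; suff /(prim_rootP xi_prim)[i ->] : x ^+ (q ^ 2).-1 = 1 by exists i.
apply: (mulfI x0); rewrite -exprS mulr1 prednK ?expn_gt0 ?(ltn_trans _ q_gt2) //.
by rewrite -cardF expf_card.
Qed.

Lemma xi_neq0 : xi != 0.
Proof. by rewrite (prim_root_eq0 xi_prim) -lt0n; have := q_gt2; nia. Qed.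

(** In a cyclic group of order nk the kernel of the k-th power is the group of n-th powers. Norms
    and Hilbert 90 are the cases n = q + 1 and n = q - 1. *)
Lemma root_ex n k (x : F) : (n * k = (q ^ 2).-1)%N -> x ^+ k = 1 ->
  exists2 y, y != 0 & y ^+ n = x.
Proof.
move=> nk xk; have m0 : (0 < n * k)%N by rewrite nk; have := q_gt2; nia.
have k0 : (0 < k)%N by move: m0; rewrite muln_gt0 => /andP[].
have [i xE] : exists i : nat, x = xi ^+ i.
  apply: xi_pow; apply: contra_eq_neq xk => ->.
  by rewrite expr0n gtn_eqF // eq_sym oner_neq0.
move/eqP: xk; rewrite xE -exprM -(prim_order_dvd xi_prim) -nk dvdn_pmul2r //.
move=> /dvdnP[j ->]; exists (xi ^+ j); last by rewrite exprM.
by rewrite expf_neq0 // xi_neq0.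
Qed.

Lemma xi_prim_dvd n k : (n * k = (q ^ 2).-1)%N -> n.-primitive_root (xi ^+ k).
Proof.
move=> nk; have m0 : (0 < n * k)%N by rewrite nk; have := q_gt2; nia.
have n0 : (0 < n)%N by move: m0; rewrite muln_gt0 => /andP[].
have := dvdn_prim_root xi_prim (_ : n %| (q ^ 2).-1)%N.
by rewrite -nk mulKn // => -> //; rewrite dvdn_mulr.
Qed.

Lemma card_unity n k : (n * k = (q ^ 2).-1)%N -> #|[set a : F | a ^+ n == 1]| = n.
Proof.
move=> /xi_prim_dvd zp.
rewrite -[RHS]card_ord -(@card_imset _ _ (fun i : 'I_n => (xi ^+ k) ^+ i)).
  apply: eq_card => a; rewrite inE; apply/eqP/imsetP => [|[i _ ->]].
    by move=> /(prim_rootP zp)[i ->]; exists i.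
  by rewrite exprAC (prim_expr_order zp) expr1n.
move=> i j /eqP; rewrite (eq_prim_root_expr zp) !modn_small // => /eqP.
exact: val_inj.
Qed.

Lemma normE (x : F) : x * cj x = x ^+ q.+1. Proof. by rewrite exprS. Qed.

Lemma cj_fix (x : F) : cj x = x -> x != 0 -> x ^+ q.-1 = 1.
Proof.
move=> xx x0; apply: (mulfI x0); rewrite -exprS mulr1 prednK //.
exact: ltn_trans q_gt2.
Qed.

Lemma norm_surj (x : F) : cj x = x -> exists y, y * cj y = x.
Proof.
have [->|x0 /cj_fix/(_ x0)] := eqVneq x 0; first by exists 0; rewrite mul0r.
by move=> /(root_ex (esym sqq1))[y _ <-]; exists y; exact: normE.
Qed.

Lemma hilbert90 (x : F) : x * cj x = 1 -> exists2 y, y != 0 & cj y = x * y.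
Proof.
rewrite normE => /(@root_ex q.-1)[|y y0 <-]; first by rewrite sqq1 mulnC.
by exists y => //; rewrite -exprSr prednK // (ltn_trans _ q_gt2).
Qed.

(** An element of F_q is a norm y^(q+1), and q + 1 is even. *)
Lemma fix_sqr (x : F) : cj x = x -> exists r, r ^+ 2 = x.
Proof.
move=> /norm_surj[y <-]; exists (y ^+ q.+1./2); rewrite normE -exprM muln2.
by rewrite -[in RHS](odd_double_half q.+1) /= q_odd.
Qed.

Definition is_sqr x := [exists y : F, x == y ^+ 2].

Lemma is_sqrP x : reflect (exists y : F, x = y ^+ 2) (is_sqr x).
Proof. by apply: (iffP existsP) => -[y E]; exists y; apply/eqP. Qed.

Lemma is_sqrV (x : F) : is_sqr x^-1 = is_sqr x.
Proof.
by apply/is_sqrP/is_sqrP => -[y E]; exists y^-1; rewrite exprVn -E ?invrK.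
Qed.

Lemma is_sqrM (x y : F) : x != 0 -> is_sqr x -> is_sqr (x * y) = is_sqr y.
Proof.
move=> x0 /is_sqrP[a E]; rewrite E in x0 *.
apply/is_sqrP/is_sqrP => -[b Eb]; last by exists (a * b); rewrite exprMn Eb.
by exists (b / a); rewrite exprMn exprVn -Eb mulrAC mulfV ?mul1r.
Qed.

Lemma nonsqrM (x y : F) : ~~ is_sqr x -> ~~ is_sqr y -> is_sqr (x * y).
Proof.
have nsq z : ~~ is_sqr z -> exists i, z = xi * (xi ^+ i) ^+ 2.
  move=> nz; have /xi_pow[i E] : z != 0.
    by apply: contraNneq nz => ->; apply/is_sqrP; exists 0; rewrite expr0n.
  move: nz; rewrite E -(odd_double_half i) -mul2n; case: (odd i) => /=.
    by rewrite exprD expr1 => _; exists i./2; rewrite mulnC exprM.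
  by rewrite add0n => /is_sqrP[]; exists (xi ^+ i./2); rewrite mulnC exprM.
move=> /nsq[i ->] /nsq[j ->]; apply/is_sqrP.
by exists (xi * xi ^+ i * xi ^+ j); ring.
Qed.

Lemma fix_is_sqr (x : F) : cj x = x -> is_sqr x.
Proof. by move=> /fix_sqr[r <-]; apply/is_sqrP; exists r. Qed.

Lemma skew_ex : exists2 eps, eps != 0 & cj eps = - eps.
Proof.
have [|y y0 yE] := @hilbert90 (-1); first by rewrite !cjE; ring.
by exists y => //; rewrite yE mulN1r.
Qed.

Lemma eq_opp0 (x : F) : x = - x -> x = 0.
Proof.
move=> h; apply/eqP; have := two_neq0; apply: contraNT => x0.
by apply/eqP/(mulIf x0); rewrite mul0r mulr_natl mulr2n {2}h subrr.
Qed.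

Lemma fix_skew0 (x : F) : cj x = x -> cj x = - x -> x = 0.
Proof. by move=> -> /eq_opp0. Qed.

(** * Equivalence of sesquilinear forms *)

Local Notation act := (@kron_act q F).
Local Notation sesq := (@sesq_form q F).
Local Notation hermf := (@hermf q F).

Lemma vec4E (a b c d : F) : ((vec4 a b c d 0 0 = a) * (vec4 a b c d 1 0 = b) *
  (vec4 a b c d 2%:R 0 = c) * (vec4 a b c d 3%:R 0 = d))%type.
Proof. by rewrite !mxE. Qed.

Lemma vec4Z (l a b c d : F) :
  l *: vec4 a b c d = vec4 (l * a) (l * b) (l * c) (l * d).
Proof.
apply/matrixP=> i j; rewrite !mxE.
by case: i => [[|[|[|[|i]]]] // ?].
Qed.

Lemma hermfE (v : 'cV[F]_4) : hermf v = cj (v 0 0) * v 3%:R 0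
  + v 0 0 * cj (v 3%:R 0) - v 1 0 * cj (v 1 0) - v 2%:R 0 * cj (v 2%:R 0).
Proof. by rewrite !normE. Qed.

Lemma actM A B v : act (A *m B) v = act A (act B v).
Proof.
by rewrite /kron_act (frob_mxM p_prime q_def cardF) -tensmx_mul mulmxA.
Qed.

Lemma act1 v : act 1%:M v = v.
Proof. by rewrite /kron_act (frob_mx1 _ p_prime q_def) tens1mx1 mul1mx. Qed.

Lemma actZ A l v : act A (l *: v) = l *: act A v.
Proof. by rewrite /kron_act scalemxAr. Qed.

Lemma actZl a A v : act (a *: A) v = (a * cj a) *: act A v.
Proof.
rewrite [A]mx2_eta; set A' := mx2 _ _ _ _.
have -> : a *: A' = mx2 (a * A 0 0) (a * A 0 1) (a * A 1 0) (a * A 1 1).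
  by rewrite [LHS]mx2_eta !mxE.
by rewrite !actE vec4Z /sesq_form; congr vec4; rewrite !cjE; ring.
Qed.

Lemma hermfZ l v : hermf (l *: v) = l * cj l * hermf v.
Proof. by rewrite !hermfE !mxE !cjE; ring. Qed.

Lemma quadfZ l (v : 'cV[F]_4) : quadf (l *: v) = l ^+ 2 * quadf v.
Proof. by rewrite /quadf !mxE; ring. Qed.

Lemma hermf_act A v : hermf (act A v) = \det A * cj (\det A) * hermf v.
Proof.
rewrite [A]mx2_eta det_mx2 actE !hermfE !vec4E /sesq_form !cjE; ring.
Qed.

Lemma quadf_act A v : quadf (act A v) = \det A * cj (\det A) * quadf v.
Proof.
rewrite [A]mx2_eta det_mx2 actE /quadf !vec4E /sesq_form !cjE; ring.
Qed.

Lemma hermf_fix v : cj (hermf v) = hermf v.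
Proof. by rewrite hermfE !cjE; ring. Qed.

(** For nonzero vectors, this says that the points they span lie in one orbit of [grpG]. *)
Definition eqv v w := exists2 A : 'M[F]_2, A \in unitmx &
  exists2 l, l != 0 & w = l *: act A v.

Lemma eqv_refl v : eqv v v.
Proof.
by exists 1%:M; rewrite ?unitmx1 //; exists 1; rewrite ?oner_neq0 // act1 scale1r.
Qed.

Lemma eqv_trans v w x : eqv v w -> eqv w x -> eqv v x.
Proof.
move=> [A uA [l l0 ->]] [B uB [m m0 ->]]; exists (B *m A).
  by rewrite unitmx_mul uB.
by exists (m * l); rewrite ?mulf_neq0 // actM actZ scalerA.
Qed.

Lemma eqv_sym v w : eqv v w -> eqv w v.
Proof.
move=> [A uA [l l0 ->]]; exists (invmx A); first by rewrite unitmx_inv.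
exists l^-1; first by rewrite invr_eq0.
by rewrite actZ scalerA mulVf // scale1r -actM mulVmx // act1.
Qed.

Lemma eqv_act2 (v : 'cV[F]_4) (a b c d l : F) : a * d - b * c != 0 -> l != 0 ->
  eqv v (vec4 (l * sesq v a b a b) (l * sesq v a b c d)
              (l * sesq v c d a b) (l * sesq v c d c d)).
Proof.
move=> D l0; exists (mx2 a b c d); first by rewrite unitmxE det_mx2 unitfE.
by exists l => //; rewrite actE vec4Z.
Qed.

Lemma eqv_diag (x y z t : F) (a d l : F) : a != 0 -> d != 0 -> l != 0 ->
  eqv (vec4 x y z t) (vec4 (l * (a * cj a * x)) (l * (cj a * d * y))
                       (l * (a * cj d * z)) (l * (d * cj d * t))).
Proof.
move=> a0 d0 l0; have := @eqv_act2 (vec4 x y z t) a 0 0 d l.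
rewrite /sesq_form !vec4E !cjE mulr0 subr0 mulf_neq0 // => /(_ isT l0).
by congr (eqv _ (vec4 _ _ _ _)); ring.
Qed.

Lemma eqv_swap (x y z t : F) : eqv (vec4 x y z t) (vec4 t z y x).
Proof.
have := @eqv_act2 (vec4 x y z t) 0 1 1 0 1.
rewrite /sesq_form !vec4E !cjE mulr0 mulr1 sub0r oppr_eq0 oner_neq0.
by move=> /(_ isT isT); congr (eqv _ (vec4 _ _ _ _)); ring.
Qed.

(** Effect of adding [t] times the first basis vector to the second. *)
Lemma eqv_shear (t x y z w : F) : eqv (vec4 x y z w)
  (vec4 x (y + t * x) (z + cj t * x) (w + t * z + cj t * y + t * cj t * x)).
Proof.
have := @eqv_act2 (vec4 x y z w) 1 0 t 1 1.
rewrite /sesq_form !vec4E !cjE mulr1 mul0r subr0 oner_neq0.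
by move=> /(_ isT isT); congr (eqv _ (vec4 _ _ _ _)); ring.
Qed.

Lemma four_neq0 : 4%:R != 0 :> F.
Proof. by rewrite (natrM _ 2 2) mulf_neq0 ?two_neq0. Qed.

Lemma kernel2 (a b c d : F) : a * d - b * c = 0 ->
  exists r s : F, [/\ (r != 0) || (s != 0), a * r + b * s = 0 & c * r + d * s = 0].
Proof.
move=> D0; have [ab0|] := boolP ((a == 0) && (b == 0)).
  have [cd0|nz] := boolP ((c == 0) && (d == 0)).
    move: ab0 cd0 => /andP[/eqP-> /eqP->] /andP[/eqP-> /eqP->].
    by exists 1, 0; rewrite oner_neq0 !mul0r addr0.
  exists d, (- c); move: ab0 nz => /andP[/eqP-> /eqP->].
  by rewrite negb_and oppr_eq0 orbC !mul0r addr0; split=> //; ring.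
rewrite negb_and => nz; exists b, (- a); rewrite oppr_eq0 orbC.
by split=> //; [ring | rewrite -oppr0 -D0; ring].
Qed.

(* The kernel vector taken first spans an eigenvector of the cosquare of the  *)
(* form, whose eigenvalues lie in [F]: the discriminant [h^2 - 4 d cj d] of   *)
(* the characteristic polynomial is fixed by [cj].                            *)
Lemma eigen_form v : quadf v != 0 -> exists x y z t mu : F,
  [/\ eqv v (vec4 x y z t), mu != 0, cj x = mu * x & cj y = mu * z].
Proof.
move=> d0; set d := quadf v in d0; set h := hermf v.
have [r rE] : exists r, r ^+ 2 = h ^+ 2 - 4%:R * (d * cj d).
  have hE : cj h = h by exact: hermf_fix.
  by move: (h) (d) hE => a b aE; apply: fix_sqr; rewrite !cjE aE; ring.
(* A root of d X^2 - h X + cj d, the determinant of the conjugate transpose of the form minus X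
   times the form; [n1], ..., [n4] below are the entries of that matrix at X = [mu]. *)
pose mu := (h + r) / (2%:R * d).
have t0 := two_neq0; have f0 := four_neq0.
have muE : cj d - mu * h + mu ^+ 2 * d = 0.
  have -> : cj d - mu * h + mu ^+ 2 * d =
    (r ^+ 2 - (h ^+ 2 - 4%:R * (d * cj d))) / (4%:R * d).
    by rewrite /mu; field; rewrite d0 f0 t0.
  by rewrite rE subrr mul0r.
have mu0 : mu != 0.
  apply: contraNneq d0 => m0; move: muE.
  by rewrite m0 mul0r subr0 expr0n mul0r addr0 => /eqP; rewrite cj_eq0.
pose n1 := cj (v 0 0) - mu * v 0 0; pose n2 := cj (v 2%:R 0) - mu * v 1 0.
pose n3 := cj (v 1 0) - mu * v 2%:R 0; pose n4 := cj (v 3%:R 0) - mu * v 3%:R 0.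
have [|r1 [r2 [r0 e1 e2]]] := @kernel2 n1 n2 n3 n4.
  by rewrite -[RHS]muE /h /d /quadf hermfE /n1 /n2 /n3 /n4 !cjE; ring.
have [s1 [s2 s0]] : exists s1 s2, r1 * s2 - r2 * s1 != 0.
  case/orP: r0 => r0; first by exists 0, 1; rewrite mulr1 mulr0 subr0.
  by exists 1, 0; rewrite mulr1 mulr0 sub0r oppr_eq0.
(* This is what lying in the kernel means for (r1, r2). Pairing it with itself and with the second
   basis vector gives the two relations claimed. *)
have E s s' : cj (sesq v r1 r2 s s') = mu * sesq v s s' r1 r2.
  apply/eqP; rewrite -subr_eq0; apply/eqP.
  transitivity (cj s * (n1 * r1 + n2 * r2) + cj s' * (n3 * r1 + n4 * r2)).
    by rewrite /sesq_form !cjE /n1 /n2 /n3 /n4; ring.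
  by rewrite e1 e2 !mulr0 addr0.
have := @eqv_act2 v r1 r2 s1 s2 1 s0 (oner_neq0 _); rewrite !mul1r => ev.
by do 4!eexists; exists mu; split; [exact: ev | | exact: E | exact: E].
Qed.

Variable eps : F.
Hypotheses (eps0 : eps != 0) (epsE : cj eps = - eps).

Lemma skew_fixM x : cj x = - x -> cj (x / eps) = x / eps.
Proof. by move=> xE; rewrite !cjE xE epsE invrN mulrNN. Qed.

(** If the eigenvector is not isotropic, its complement splits off and the form is diagonal. If it
    is isotropic, shears move [t] by [s * z + cj s * y]: this reaches every value when [y] and [z]
    have different norms, and otherwise, after scaling both to 1, only the traces, so that a skew
    [t] remains, which norms scale to 0 or [eps]. *)
Lemma norm_form v : quadf v != 0 ->
  [\/ exists2 b, b != 0 & eqv v (vec4 1 0 0 b),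
      exists2 c, c != 0 & eqv v (vec4 0 1 c 0) | eqv v (vec4 0 1 1 eps)].
Proof.
move=> d0; have [x [y [z [t [mu [ev mu0 xE yE]]]]]] := eigen_form d0.
have t0 := two_neq0; have f0 := four_neq0.
have {d0} : quadf (vec4 x y z t) != 0.
  move: ev => [A uA [l l0 ->]].
  have D0 : \det A != 0 by rewrite -unitfE -unitmxE.
  by rewrite quadfZ quadf_act !mulf_neq0 ?expf_neq0 ?cj_eq0.
rewrite /quadf !vec4E; have [x0|x0] := eqVneq x 0; last first.
  move=> d0; apply: Or31.
  (* The shear that clears [y] also clears [z], because [cj y / cj x = z / x]. *)
  have {}ev := eqv_trans ev (eqv_shear (- y / x) x y z t).
  exists ((t - y * z / x) / x).
    have -> : (t - y * z / x) / x = (x * t - y * z) / x ^+ 2 by field.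
    by rewrite mulf_neq0 // invr_eq0 expf_neq0.
  apply: eqv_trans ev _; have xi0 : x^-1 != 0 by rewrite invr_eq0.
  have := eqv_diag x (y + - y / x * x) (z + cj (- y / x) * x)
    (t + - y / x * z + cj (- y / x) * y + - y / x * cj (- y / x) * x)
    (oner_neq0 _) (oner_neq0 _) xi0.
  rewrite !cjE xE yE; congr (eqv _ (vec4 _ _ _ _)); field; by rewrite ?x0 ?mu0.
rewrite x0 mul0r sub0r oppr_eq0 mulf_eq0 negb_or => /andP[y0 z0].
rewrite {x xE}x0 in ev.
have [nE|nE] := eqVneq (z * cj z) (y * cj y); last first.
  apply: Or32; exists (z / y); first by rewrite mulf_neq0 ?invr_eq0.
  apply: eqv_trans ev _.
  have n0 : z * cj z - y * cj y != 0 by rewrite subr_eq0.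
  (* Cramer's rule for [t + s * z + cj s * y = 0] and its conjugate, in the unknowns [s] and
     [cj s]. *)
  pose s := (y * cj t - t * cj z) / (z * cj z - y * cj y).
  have csE : cj s = (cj y * t - cj t * z) / (z * cj z - y * cj y).
    by rewrite cjM cjV !cjE (mulrC (cj z)) (mulrC (cj y) y).
  have := eqv_shear s 0 y z t.
  have -> : t + s * z + cj s * y + s * cj s * 0 = 0 by rewrite csE /s; field.
  rewrite !mulr0 !addr0 => /eqv_trans; apply.
  have yi0 : y^-1 != 0 by rewrite invr_eq0.
  have := eqv_diag 0 y z 0 (oner_neq0 _) (oner_neq0 _) yi0.
  by rewrite !cjE; congr (eqv _ (vec4 _ _ _ _)); field.
have [|a a0 aE] := @hilbert90 (y / z).
  by rewrite !cjE mulrACA -invfM -nE mulfV ?mulf_neq0 ?cj_eq0.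
have l0 : (a * y)^-1 != 0 by rewrite invr_eq0 mulf_neq0.
have := eqv_diag 0 y z t (oner_neq0 _) a0 l0.
set w := _ * (a * cj a * t).
have -> : vec4 ((a * y)^-1 * (1 * cj 1 * 0)) ((a * y)^-1 * (cj 1 * a * y))
  ((a * y)^-1 * (1 * cj a * z)) w = vec4 0 1 1 w.
  by rewrite !cjE aE; congr vec4; field; rewrite ?a0 ?y0 ?z0.
move=> /(eqv_trans ev){}ev; move: w ev => w ev {l0 aE a0 a nE y0 z0 yE t y z mu mu0}.
(* This shear subtracts half the trace of [w] and leaves its skew part [w']. *)
have {}ev := eqv_trans ev (eqv_shear (- (w + cj w) / 4%:R) 0 1 1 w).
pose w' := (w - cj w) / 2%:R.
have w'E : cj w' = - w' by rewrite /w' !cjE; field.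
have {}ev : eqv v (vec4 0 1 1 w').
  by move: ev; rewrite !cjE; congr (eqv _ (vec4 _ _ _ _));
    rewrite /w'; field; rewrite ?t0 ?f0.
have [w0|w0] := eqVneq w' 0.
  by apply: Or32; exists 1; [exact: oner_neq0 | rewrite w0 in ev].
apply: Or33; apply: eqv_trans ev _.
have [a aE] := norm_surj (skew_fixM w'E).
have : w' / eps != 0 by rewrite mulf_neq0 ?invr_eq0.
rewrite -aE mulf_eq0 cj_eq0 orbb => a0.
have E : w' = a * cj a * eps by rewrite aE; field.
have ca0 : cj a != 0 by rewrite cj_eq0.
have ai0 : a^-1 != 0 by rewrite invr_eq0.
have := eqv_diag 0 1 1 w' ca0 ai0 (oner_neq0 _).
by rewrite !cjE E; congr (eqv _ (vec4 _ _ _ _)); field; rewrite ?a0 ?ca0.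
Qed.

(** * Invariants of points *)

Lemma hermf4 (a b c d : F) :
  hermf (vec4 a b c d) = cj a * d + a * cj d - b * cj b - c * cj c.
Proof. by rewrite hermfE !vec4E. Qed.

Lemma quadf4 (a b c d : F) : quadf (vec4 a b c d) = a * d - b * c.
Proof. by rewrite /quadf !vec4E. Qed.

Definition herm (v : 'cV[F]_4) :=
  [&& cj (v 0 0) == v 0 0, cj (v 1 0) == v 2%:R 0 & cj (v 3%:R 0) == v 3%:R 0].

(* [v] represents a point of Sigma, see [mem_Sigma]. *)
Definition sig v := [exists l, (l != 0) && herm (l *: v)].

Lemma sigP v : reflect (exists2 l, l != 0 & herm (l *: v)) (sig v).
Proof.
by apply: (iffP existsP) => [[l /andP[]]|[l l0 hl]]; exists l => //; apply/andP.
Qed.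

Lemma herm_act A v : herm v -> herm (act A v).
Proof.
rewrite [A]mx2_eta actE /herm !vec4E /sesq_form => /and3P[/eqP e0 /eqP e1 /eqP e3].
have e2 : cj (v 2%:R 0) = v 1 0 by rewrite -e1 cjK.
by apply/and3P; split; apply/eqP; rewrite !cjE ?e0 ?e1 ?e2 ?e3; ring.
Qed.

Lemma sig_eqv_imp v w : eqv v w -> sig v -> sig w.
Proof.
move=> [A _ [l l0 ->]] /sigP[m m0 hm]; apply/sigP; exists (m / l).
  by rewrite mulf_neq0 ?invr_eq0.
by rewrite scalerA divfK // -actZ herm_act.
Qed.

Lemma sig_eqv v w : eqv v w -> sig v = sig w.
Proof.
by move=> vw; apply/idP/idP; apply: sig_eqv_imp => //; apply: eqv_sym.
Qed.

(** On the quadric the division by zero returns 0, a value that [label] never reads. *)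
Definition sinv (v : 'cV[F]_4) := hermf v ^+ 2 / (quadf v * cj (quadf v)).

(* The boolean tells apart the two orbits lying over [None] (the quadric), 0  *)
(* (the Hermitian surface) and 4 (the points of Sigma and the others).        *)
Definition label (v : 'cV[F]_4) : option F * bool :=
  if quadf v == 0 then (None, hermf v == 0)
  else (Some (sinv v),
        if sinv v == 0 then is_sqr (eps * quadf v)
        else if sinv v == 4%:R then sig v else false).

Lemma label_eqv v w : eqv v w -> label v = label w.
Proof.
move=> vw; rewrite /label (sig_eqv vw); move: vw => [A uA [l l0 ->]].
have D0 : \det A != 0 by rewrite -unitfE -unitmxE.
have cD0 : cj (\det A) != 0 by rewrite cj_eq0.
have cl0 : cj l != 0 by rewrite cj_eq0.
have -> : (quadf (l *: act A v) == 0) = (quadf v == 0).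
  have k0 : l ^+ 2 * (\det A * cj (\det A)) != 0 by rewrite !mulf_neq0.
  by rewrite quadfZ quadf_act mulrA mulf_eq0 (negPf k0).
have -> : (hermf (l *: act A v) == 0) = (hermf v == 0).
  have k0 : l * cj l * (\det A * cj (\det A)) != 0 by rewrite !mulf_neq0.
  by rewrite hermfZ hermf_act mulrA mulf_eq0 (negPf k0).
have [//|d0] := eqVneq (quadf v) 0; have cd0 : cj (quadf v) != 0 by rewrite cj_eq0.
have -> : sinv (l *: act A v) = sinv v.
  rewrite /sinv quadfZ quadf_act hermfZ hermf_act; move: (hermf v) => h.
  by move: (quadf v) d0 cd0 => d d0 cd0; rewrite !cjE; field;
    rewrite l0 D0 cD0 cl0 d0 cd0.
congr (_, if _ then _ else _).
(* [quadf] is multiplied by l^2 times the norm of det A; that norm lies in F_q, so it is a square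
   and the quadratic character is kept. *)
have /fix_sqr[r rE] : cj (\det A * cj (\det A)) = \det A * cj (\det A).
  by rewrite !cjE mulrC.
rewrite quadfZ quadf_act -rE mulrA -(is_sqrM (x := (l * r) ^+ 2)).
- by congr (is_sqr _); rewrite exprMn; ring.
- by rewrite exprMn rE !mulf_neq0.
- by apply/is_sqrP; exists (l * r).
Qed.

(** Rescaling the second basis vector multiplies [b] by a norm, and swapping the two vectors
    replaces [b] by its inverse up to a scalar. The alternatives say that [c / b] or [b * c] lies in
    F_q, hence is a norm. *)
Lemma diag_eqv (b c : F) : b != 0 -> c != 0 ->
  b * cj c = cj b * c \/ b * c = cj b * cj c ->
  eqv (vec4 1 0 0 b) (vec4 1 0 0 c).
Proof.
move=> b0 c0 [E|E].
  have [a aE] : exists a, a * cj a = c / b.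
    apply: norm_surj; rewrite !cjE; apply/eqP.
    by rewrite eqr_div ?cj_eq0 // mulrC E mulrC.
  have a0 : a != 0.
    have : c / b != 0 by rewrite mulf_neq0 ?invr_eq0.
    by rewrite -aE; apply: contraNneq => ->; rewrite mul0r.
  have := eqv_diag 1 0 0 b (oner_neq0 _) a0 (oner_neq0 _).
  by rewrite aE !cjE; congr (eqv _ (vec4 _ _ _ _)); field.
have [a aE] : exists a, a * cj a = b * c by apply: norm_surj; rewrite !cjE E.
have a0 : a != 0.
  have : b * c != 0 by rewrite mulf_neq0.
  by rewrite -aE; apply: contraNneq => ->; rewrite mul0r.
have bi0 : b^-1 != 0 by rewrite invr_eq0.
have := eqv_diag b 0 0 1 (oner_neq0 _) a0 bi0.
move=> /(eqv_trans (eqv_swap 1 0 0 b)).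
by rewrite aE !cjE; congr (eqv _ (vec4 _ _ _ _)); field.
Qed.

(** Rescaling multiplies [b] by any element of norm 1 (Hilbert 90), and swapping the basis inverts
    it, so only the norm up to inversion matters. *)
Lemma anti_eqv (b c : F) : b != 0 -> c != 0 ->
  b * cj b = c * cj c \/ b * cj b * (c * cj c) = 1 ->
  eqv (vec4 0 1 b 0) (vec4 0 1 c 0).
Proof.
move=> + c0; have main d : d != 0 -> d * cj d = c * cj c ->
    eqv (vec4 0 1 d 0) (vec4 0 1 c 0).
  move=> d0 E; have [|a a0 aE] := @hilbert90 (c / d).
    by rewrite !cjE mulrACA -invfM E mulfV // mulf_neq0 ?cj_eq0.
  have ai0 : a^-1 != 0 by rewrite invr_eq0.
  have := eqv_diag 0 1 d 0 (oner_neq0 _) a0 ai0.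
  by rewrite aE !cjE; congr (eqv _ (vec4 _ _ _ _)); field; rewrite ?a0 ?d0.
move=> b0 [/main|E]; first exact.
have bi0 : b^-1 != 0 by rewrite invr_eq0.
apply: eqv_trans (main b^-1 bi0 _); last first.
  by rewrite !cjE -invfM -[LHS]mulr1 -E mulKf ?mulf_neq0 ?cj_eq0.
have := eqv_diag 0 b 1 0 (oner_neq0 _) (oner_neq0 _) bi0.
move=> /(eqv_trans (eqv_swap 0 1 b 0)).
by rewrite !cjE; congr (eqv _ (vec4 _ _ _ _)); field.
Qed.

(** In the hyperbolic plane the basis (1, 1/2), (1, -1/2) has Gram matrix diag(1, -1), and -1 is a
    norm. *)
Lemma diag_anti1 : eqv (vec4 1 0 0 1) (vec4 0 1 1 0).
Proof.
have t0 := two_neq0; apply: eqv_sym.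
have D0 : 1 * - 2%:R^-1 - 2%:R^-1 * 1 != 0 :> F.
  have -> : 1 * - 2%:R^-1 - 2%:R^-1 * 1 = -1 :> F by field.
  by rewrite oppr_eq0 oner_neq0.
apply: eqv_trans (eqv_act2 (vec4 0 1 1 0) D0 (oner_neq0 _)) _.
have m0 : -1 != 0 :> F by rewrite oppr_eq0 oner_neq0.
have : eqv (vec4 1 0 0 (-1)) (vec4 1 0 0 1).
  by apply: diag_eqv; rewrite ?oner_neq0 //; left; rewrite !cjE.
rewrite /sesq_form !vec4E !cjE.
by congr (eqv (vec4 _ _ _ _) _); field.
Qed.

Lemma sinv_eq v w : quadf v != 0 -> quadf w != 0 -> sinv v = sinv w ->
  hermf v ^+ 2 * (quadf w * cj (quadf w)) = hermf w ^+ 2 * (quadf v * cj (quadf v)).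
Proof. by move=> v0 w0 /eqP; rewrite eqr_div ?mulf_neq0 ?cj_eq0 // => /eqP. Qed.

(** Both invariants have the shape u + 2 + u^-1, with u = [cj b / b] and u = [c * cj c], so these
    values agree up to inversion. The first has norm 1 and the second lies in F_q, which leaves 1
    and -1. *)
Lemma sinv_diag_anti (b c : F) : b != 0 -> c != 0 ->
  sinv (vec4 1 0 0 b) = sinv (vec4 0 1 c 0) ->
  cj b = b /\ c * cj c = 1 \/ cj b = - b /\ c * cj c = -1.
Proof.
move=> b0 c0 /sinv_eq; rewrite !quadf4 !hermf4 !cjE => E.
have {}E := E ltac:(by rewrite mul1r mulr0 subr0)
  ltac:(by rewrite mul0r mul1r sub0r oppr_eq0).
have : (b * (c * cj c) - cj b) * (b - (c * cj c) * cj b) = 0.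
  transitivity ((1 * b + 1 * cj b - 0 * 0 - 0 * 0) ^+ 2
      * ((0 * 0 - 1 * c) * (0 * 0 - 1 * cj c))
    - (1 * b - 0 * 0) * (1 * cj b - 0 * 0) * (0 * 0 + 0 * 0 - 1 * 1 - c * cj c) ^+ 2).
    by ring.
  by rewrite E; ring.
have nE : cj (c * cj c) = c * cj c by rewrite !cjE mulrC.
have bE : cj b = c * cj c * b ->
    cj b = b /\ c * cj c = 1 \/ cj b = - b /\ c * cj c = -1.
  move=> E1; have := congr1 cj E1; rewrite cjK cjM nE E1 => E2.
  have : (c * cj c) ^+ 2 = 1.
    by apply: (mulIf b0); rewrite mul1r [RHS]E2; ring.
  move/eqP; rewrite sqrf_eq1 => /orP[]/eqP n; rewrite n in E1 *.
    by left; rewrite mul1r.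
  by right; rewrite mulN1r.
move/eqP; rewrite mulf_eq0 !subr_eq0 => /orP[]/eqP E1; apply: bE.
  by rewrite -E1 mulrC.
by rewrite {1}E1 cjM nE cjK.
Qed.

Lemma sinv4 v : quadf v != 0 -> sinv v = 4%:R ->
  hermf v ^+ 2 = 4%:R * (quadf v * cj (quadf v)).
Proof. by move=> v0 <-; rewrite divfK // mulf_neq0 ?cj_eq0. Qed.

Lemma sinv_eqE v s : quadf v != 0 ->
  (sinv v == s) = (hermf v ^+ 2 == s * (quadf v * cj (quadf v))).
Proof.
move=> v0; have dd0 : quadf v * cj (quadf v) != 0 by rewrite mulf_neq0 ?cj_eq0.
by rewrite -(inj_eq (mulIf dd0)) divfK.
Qed.

Lemma sig_diag (b : F) : b != 0 -> sinv (vec4 1 0 0 b) = 4%:R -> sig (vec4 1 0 0 b).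
Proof.
move=> b0 /sinv4; rewrite quadf4 hermf4 cj1 cj0 !mulr0 !mul1r !subr0 => /(_ b0) E.
apply/sigP; exists 1; rewrite ?oner_neq0 // scale1r /herm !vec4E !cjE !eqxx /=.
rewrite -subr_eq0 -sqrf_eq0; apply/eqP.
transitivity ((b + cj b) ^+ 2 - 4%:R * (b * cj b)); first by ring.
by rewrite E subrr.
Qed.

(** The value 4 forces [c] to have norm 1; then Hilbert 90 gives the scalar that makes the form
    Hermitian. *)
Lemma sig_anti (c : F) : c != 0 -> sinv (vec4 0 1 c 0) = 4%:R -> sig (vec4 0 1 c 0).
Proof.
move=> c0 /sinv4; rewrite quadf4 hermf4 !cjE => E.
have {}E := E ltac:(by rewrite mul0r mul1r sub0r oppr_eq0).
have [|y y0 yE] := @hilbert90 c.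
  apply/eqP; rewrite -subr_eq0 -sqrf_eq0; apply/eqP.
  transitivity ((0 * 0 + 0 * 0 - 1 * 1 - c * cj c) ^+ 2
    - 4%:R * ((0 * 0 - 1 * c) * (0 * 0 - 1 * cj c))); first by ring.
  by rewrite E subrr.
apply/sigP; exists y => //; rewrite vec4Z /herm !vec4E !mulr0 !cjE mulr1 yE mulrC.
by rewrite !eqxx.
Qed.

Lemma nsig_skew : ~~ sig (vec4 0 1 1 eps).
Proof.
apply/sigP => -[l l0]; rewrite vec4Z /herm !vec4E mulr1 => /and3P[_ /eqP lE].
rewrite cjM lE epsE mulrN => /eqP/esym/eq_opp0/eqP.
by rewrite mulf_eq0 (negPf l0) (negPf eps0).
Qed.

Lemma sinv_skew : sinv (vec4 0 1 1 eps) = 4%:R.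
Proof.
by rewrite /sinv quadf4 hermf4 cj0 !mul0r !mul1r !sub0r cjN cj1 mulrNN !mulr1 divr1; ring.
Qed.

(** The left side is the square of an element of F_q, whereas neither [eps] nor [- eps] lies in F_q.
    Thus an element of norm [eps ^+ 2] is a nonsquare. *)
Lemma nonsqr_norm (y : F) : y ^+ 2 * cj (y ^+ 2) != eps ^+ 2.
Proof.
apply/eqP => E; have : (y * cj y) ^+ 2 = eps ^+ 2 by rewrite -E !cjE; ring.
have yE : cj (y * cj y) = y * cj y by rewrite !cjE mulrC.
move/eqP; rewrite eqf_sqr => /orP[]/eqP n; rewrite n in yE.
  by move/eqP: eps0; apply; apply: fix_skew0 epsE.
by move/eqP: eps0; apply; apply: fix_skew0 epsE; rewrite -[LHS]opprK -cjN yE opprK.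
Qed.

Lemma nonsqr_anti (c : F) : c * cj c = -1 -> ~~ is_sqr (eps * - c).
Proof.
move=> cE; apply/is_sqrP => -[y E]; have /eqP[] := nonsqr_norm y.
rewrite -E !cjE epsE.
by transitivity (- eps ^+ 2 * (c * cj c)); [ring | rewrite cE; ring].
Qed.

(** By [sinv_diag_anti] either both forms are Hermitian up to a scalar, and [diag_anti1] joins them,
    or s = 0. In the latter case [eps * b] lies in F_q and is a square while [eps * - c] is not,
    against the hypothesis. *)
Lemma diag_anti_eqv (b c : F) : b != 0 -> c != 0 ->
  sinv (vec4 1 0 0 b) = sinv (vec4 0 1 c 0) ->
  (sinv (vec4 1 0 0 b) = 0 ->
   is_sqr (eps * quadf (vec4 1 0 0 b)) = is_sqr (eps * quadf (vec4 0 1 c 0))) ->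
  eqv (vec4 1 0 0 b) (vec4 0 1 c 0).
Proof.
move=> b0 c0 E H; case: (sinv_diag_anti b0 c0 E) => -[bE cE].
  apply: eqv_trans (_ : eqv _ (vec4 1 0 0 1)) _.
    by apply: diag_eqv; rewrite ?oner_neq0 //; left; rewrite cj1 bE.
  apply: eqv_trans diag_anti1 _; apply: anti_eqv; rewrite ?oner_neq0 //.
  by left; rewrite cE cj1 mulr1.
have := nonsqr_anti cE; suff -> : is_sqr (eps * - c) by [].
have s0 : sinv (vec4 1 0 0 b) = 0.
  by rewrite /sinv hermf4 bE cj1 !mul1r !mul0r addrN !subr0 expr0n mul0r.
have := H s0; rewrite !quadf4 !mul1r !mul0r !sub0r subr0 => <-; apply: fix_is_sqr.
by rewrite cjM bE epsE mulrNN.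
Qed.

(** Cross-multiplied, the equality of invariants factors into the two alternatives of [diag_eqv]. *)
Lemma diag_diag_eqv (b c : F) : b != 0 -> c != 0 ->
  sinv (vec4 1 0 0 b) = sinv (vec4 1 0 0 c) ->
  eqv (vec4 1 0 0 b) (vec4 1 0 0 c).
Proof.
move=> b0 c0 /sinv_eq; rewrite !quadf4 !hermf4 cj0 cj1 !mul1r !mulr0 !subr0.
move=> /(_ b0 c0) E; apply: diag_eqv => //.
have : (b * cj c - cj b * c) * (b * c - cj b * cj c) = 0.
  transitivity ((b + cj b) ^+ 2 * (c * cj c) - (c + cj c) ^+ 2 * (b * cj b)).
    by ring.
  by rewrite E subrr.
by move/eqP; rewrite mulf_eq0 !subr_eq0 => /orP[]/eqP; [left | right].
Qed.

Lemma anti_anti_eqv (b c : F) : b != 0 -> c != 0 ->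
  sinv (vec4 0 1 b 0) = sinv (vec4 0 1 c 0) ->
  eqv (vec4 0 1 b 0) (vec4 0 1 c 0).
Proof.
move=> b0 c0 /sinv_eq; rewrite !quadf4 !hermf4 cj0 cj1 !mul1r !mul0r !sub0r.
rewrite !oppr_eq0 !cjN !mulrNN => /(_ b0 c0) E; apply: anti_eqv => //.
have : (b * cj b - c * cj c) * (b * cj b * (c * cj c) - 1) = 0.
  transitivity ((0 + 0 - 1 - b * cj b) ^+ 2 * (c * cj c)
    - (0 + 0 - 1 - c * cj c) ^+ 2 * (b * cj b)); first by ring.
  by move: E; rewrite !addr0 !sub0r => ->; ring.
by move/eqP; rewrite mulf_eq0 !subr_eq0 => /orP[]/eqP; [left | right].
Qed.

Lemma quadf_eqv v w : eqv v w -> quadf v != 0 -> quadf w != 0.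
Proof.
move=> /label_eqv; rewrite /label.
by case: (quadf v == 0); case: (quadf w == 0).
Qed.

(** All nine pairs of normal forms are compared. The third form has s = 4 and no Hermitian multiple,
    while the other two with s = 4 have one, so the boolean rules out the mixed pairs. *)
Lemma label_inj_nondeg v w : quadf v != 0 -> quadf w != 0 ->
  label v = label w -> eqv v w.
Proof.
have hyp x y : quadf x != 0 -> quadf y != 0 -> label x = label y ->
    [/\ sinv x = sinv y,
        sinv x = 0 -> is_sqr (eps * quadf x) = is_sqr (eps * quadf y) &
        sinv x = 4%:R -> sig x = sig y].
  move=> x0 y0; rewrite /label (negPf x0) (negPf y0) => -[E].
  rewrite -E => Eb; split=> // s; move: Eb; rewrite s ?eqxx //.
  by rewrite (negPf four_neq0).
move=> v0 w0; have := norm_form w0; have := norm_form v0.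
move=> [[b b0 ev]|[b b0 ev]|ev] [[c c0 ew]|[c c0 ew]|ew];
  rewrite (label_eqv ev) (label_eqv ew) => L;
  apply: (eqv_trans ev); apply: (fun x => eqv_trans x (eqv_sym ew));
  have := hyp _ _ (quadf_eqv ev v0) (quadf_eqv ew w0) L; move=> [E Esq Esig].
- exact: diag_diag_eqv.
- exact: diag_anti_eqv.
- have [] := negP nsig_skew; rewrite -(Esig _) ?E ?sinv_skew //.
  by apply: sig_diag => //; rewrite E sinv_skew.
- apply: eqv_sym; apply: diag_anti_eqv => // s0.
  by apply/esym/Esq; rewrite E.
- exact: anti_anti_eqv.
- have [] := negP nsig_skew; rewrite -(Esig _) ?E ?sinv_skew //.
  by apply: sig_anti => //; rewrite E sinv_skew.
- have [] := negP nsig_skew; rewrite (Esig _) ?sinv_skew //.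
  by apply: sig_diag => //; rewrite -E sinv_skew.
- have [] := negP nsig_skew; rewrite (Esig _) ?sinv_skew //.
  by apply: sig_anti => //; rewrite -E sinv_skew.
- exact: eqv_refl.
Qed.

Lemma norm_eq0 (x : F) : x * cj x = 0 -> x = 0.
Proof. by move/eqP; rewrite mulf_eq0 cj_eq0 orbb => /eqP. Qed.

(** * The quadric *)

Lemma calO_coord v : v != 0 -> quadf v = 0 -> hermf v = 0 ->
  exists2 l, l != 0 &
    (exists t, l *: v = vec4 1 t (cj t) (t * cj t)) \/ l *: v = vec4 0 0 0 1.
Proof.
rewrite [v]vec4_eta; move: (v 0 0) (v 1 0) (v 2%:R 0) (v 3%:R 0) => x y z w.
rewrite quadf4 hermf4 => v0 d0 h0; have [x0|x0] := eqVneq x 0.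
  move: v0 d0 h0; rewrite {}x0 cj0 !mul0r !add0r => v0 /eqP.
  rewrite oppr_eq0 mulf_eq0 => yz h0.
  have [y0 z0] : y = 0 /\ z = 0.
    by case/orP: yz h0 => /eqP-> h0; split=> //; apply: norm_eq0;
      apply: oppr_inj; rewrite oppr0 -[RHS]h0; ring.
  have w0 : w != 0.
    apply: contraNneq v0 => ->; rewrite y0 z0; apply/eqP/matrixP=> i j.
    by rewrite !mxE; case: i => [[|[|[|[|i]]]] // ?].
  exists w^-1; rewrite ?invr_eq0 //; right.
  by rewrite vec4Z y0 z0 !mulr0 mulVf.
exists x^-1; rewrite ?invr_eq0 //; left; exists (y / x).
have cx0 : cj x != 0 by rewrite cj_eq0.
have wE : w = y * z / x by apply: (mulfI x0); rewrite (subr0_eq d0); field.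
(* On the quadric, with [x != 0], [hermf] is minus [x * cj x] times this norm. *)
have : (y / x - cj (z / x)) * cj (y / x - cj (z / x)) = 0.
  rewrite -[RHS](mul0r (- (x * cj x)^-1)) -h0 wE !cjE; field.
  by rewrite x0 cx0.
move/eqP; rewrite mulf_eq0 cj_eq0 orbb subr_eq0 => /eqP yE.
have zE : cj (y / x) = z / x by rewrite yE cjK.
by rewrite vec4Z zE wE; congr vec4; field.
Qed.

Lemma eqv_scale v l : l != 0 -> eqv v (l *: v).
Proof.
by exists 1%:M; rewrite ?unitmx1 //; exists l; rewrite ?act1.
Qed.

Lemma calO_eqv v : v != 0 -> quadf v = 0 -> hermf v = 0 -> eqv (vec4 1 0 0 0) v.
Proof.
move=> v0 d0 h0; have [l l0 E] := calO_coord v0 d0 h0.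
apply: (fun x => eqv_trans x (eqv_sym (eqv_scale v l0))).
case: E => [[t ->]|->]; last exact: eqv_swap.
by have := eqv_shear t 1 0 0 0; congr (eqv _ (vec4 _ _ _ _)); ring.
Qed.

(** A form of rank one is the product of a conjugated linear form f and a linear form g, and [hermf]
    is minus the norm of their 2 by 2 determinant. When it is nonzero, the basis dual to f, g gives
    the normal form; shears and swaps produce it. *)
Lemma calQ_eqv v : quadf v = 0 -> hermf v != 0 -> eqv v (vec4 0 1 0 0).
Proof.
have y_eqv (b : F) : b != 0 -> eqv (vec4 0 b 0 0) (vec4 0 1 0 0).
  move=> b0; have bi0 : b^-1 != 0 by rewrite invr_eq0.
  by have := eqv_scale (vec4 0 b 0 0) bi0; rewrite vec4Z !mulr0 mulVf.
have z_eqv (b : F) : b != 0 -> eqv (vec4 0 0 b 0) (vec4 0 1 0 0).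
  by move=> b0; apply: eqv_trans (y_eqv _ b0); apply: eqv_swap.
have main x y z w : x != 0 -> x * w - y * z = 0 -> hermf (vec4 x y z w) != 0 ->
    eqv (vec4 x y z w) (vec4 0 1 0 0).
  move=> x0 d0 h0; have wE : w = y * z / x.
    by apply: (mulfI x0); rewrite (subr0_eq d0); field.
  have cx0 : cj x != 0 by rewrite cj_eq0.
  pose u := z - cj y / cj x * x.
  have u0 : u != 0.
    apply: contraNneq h0 => /subr0_eq zE; rewrite hermf4 wE zE !cjE.
    by apply/eqP; field; rewrite x0 cx0.
  have := eqv_shear (- (y / x)) x y z w.
  have -> : vec4 x (y + - (y / x) * x) (z + cj (- (y / x)) * x)
      (w + - (y / x) * z + cj (- (y / x)) * y + - (y / x) * cj (- (y / x)) * x)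
      = vec4 x 0 u 0.
    by rewrite wE /u !cjE; congr vec4; field; rewrite ?x0 ?cx0.
  move=> /eqv_trans; apply; apply: (eqv_trans (eqv_swap _ _ _ _)).
  apply: (fun v => eqv_trans v (y_eqv _ u0)).
  have := eqv_shear (- cj (x / u)) 0 u 0 x.
  by congr (eqv _ (vec4 _ _ _ _)); rewrite ?cjN ?cjK; field.
rewrite [v]vec4_eta; move: (v 0 0) (v 1 0) (v 2%:R 0) (v 3%:R 0) => x y z w {v}.
rewrite quadf4 => d0 h0; have [x0|x0] := eqVneq x 0; last exact: main.
have [w0|w0] := eqVneq w 0; last first.
  apply: (eqv_trans (eqv_swap _ _ _ _)); apply: main => //.
    by rewrite -d0; ring.
  by apply: contraNneq h0 => <-; rewrite !hermf4; apply/eqP; ring.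
move: d0 h0; rewrite x0 w0 mul0r sub0r => /eqP; rewrite oppr_eq0 mulf_eq0.
case/orP=> /eqP-> h0; [apply: z_eqv | apply: y_eqv];
  by apply: contraNneq h0 => ->; rewrite hermf4 cj0; apply/eqP; ring.
Qed.

Lemma labelP v w : v != 0 -> w != 0 -> eqv v w <-> label v = label w.
Proof.
move=> v0 w0; split=> [|E]; first exact: label_eqv.
have [dv|dv] := eqVneq (quadf v) 0; have [dw|dw] := eqVneq (quadf w) 0.
- move: E; rewrite /label dv dw eqxx => -[].
  have [hv|hv] := eqVneq (hermf v) 0 => /esym/eqP hw.
    by apply: eqv_trans (calO_eqv w0 dw hw); apply/eqv_sym/calO_eqv.
  by apply: eqv_trans (calQ_eqv dv hv) _; apply/eqv_sym/calQ_eqv/eqP.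
- by move: E; rewrite /label dv eqxx (negPf dw).
- by move: E; rewrite /label dw eqxx (negPf dv).
exact: label_inj_nondeg.
Qed.

(** * The attained labels and their number *)

Lemma sinv_fix v : cj (sinv v) = sinv v.
Proof.
rewrite /sinv cjM cjV cjX hermf_fix cjM cjK; congr (_ / _); exact: mulrC.
Qed.

Definition labels : {set option F * bool} :=
  [set (None, true); (None, false); (Some 0, true); (Some 4%:R, true)]
  :|: [set (Some s, false) | s in [set s : F | cj s == s]].

Lemma label_in v : label v \in labels.
Proof.
rewrite /label !inE; case: (quadf v == 0); first by case: (hermf v == 0).
case s0: (sinv v == 0); first rewrite (eqP s0).
  case: (is_sqr _); first by rewrite !eqxx ?orbT.
  by apply/orP; right; apply/imsetP; exists 0; rewrite ?inE ?cj0.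
case s4: (sinv v == 4%:R); first rewrite (eqP s4).
  case: (sig _); first by rewrite !eqxx ?orbT.
  by apply/orP; right; apply/imsetP; exists 4%:R; rewrite ?inE ?cjn.
by apply/orP; right; apply/imsetP; exists (sinv v); rewrite ?inE ?sinv_fix.
Qed.

Lemma vec4_neq0 (a b c d : F) :
  [|| a != 0, b != 0, c != 0 | d != 0] -> vec4 a b c d != 0.
Proof.
apply: contraTneq => E; have := vec4E a b c d.
by rewrite E !mxE => -[[[<- <-] <-] <-]; rewrite !eqxx.
Qed.

Lemma label_diag (b : F) : b != 0 -> cj b = - b ->
  label (vec4 1 0 0 b) = (Some 0, is_sqr (eps * b)).
Proof.
move=> b0 bE; have hE : hermf (vec4 1 0 0 b) = 0.
  by rewrite hermf4 bE cj0 cj1; ring.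
by rewrite /label /sinv hE quadf4 mul1r mul0r subr0 (negPf b0) expr0n mul0r eqxx.
Qed.

Lemma label_diag0 : label (vec4 1 0 0 eps) = (Some 0, true).
Proof. by rewrite label_diag // fix_is_sqr // cjM epsE mulrNN. Qed.

Lemma label_anti0 (c : F) : c * cj c = -1 ->
  label (vec4 0 1 c 0) = (Some 0, false).
Proof.
move=> cE; have c0 : c != 0.
  have := oner_neq0 F; apply: contraNneq => c0; move: cE.
  by rewrite c0 mul0r => /esym/eqP; rewrite oppr_eq0.
have hE : hermf (vec4 0 1 c 0) = 0 by rewrite hermf4 cE cj0 cj1; ring.
rewrite /label /sinv hE quadf4 mul1r mul0r sub0r oppr_eq0 (negPf c0) expr0n mul0r.
by rewrite eqxx (negPf (nonsqr_anti cE)).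
Qed.

Lemma label_onto l : l \in labels -> exists2 v, v != 0 & label v = l.
Proof.
have one0 := oner_neq0 F.
rewrite !inE => /orP[|/imsetP[s /[!inE]/eqP sE ->]].
  rewrite -!orbA => /or4P[]/eqP->.
  - exists (vec4 1 0 0 0); first by rewrite vec4_neq0 ?one0.
    have dE : quadf (vec4 1 0 0 0) = 0 :> F by rewrite quadf4; ring.
    have hE : hermf (vec4 1 0 0 0) = 0 by rewrite hermf4 cj0; ring.
    by rewrite /label dE hE eqxx.
  - exists (vec4 0 1 0 0); first by rewrite vec4_neq0 ?one0 ?orbT.
    have dE : quadf (vec4 0 1 0 0) = 0 :> F by rewrite quadf4; ring.
    have hE : hermf (vec4 0 1 0 0) = -1 by rewrite hermf4 cj0 cj1; ring.
    by rewrite /label dE hE eqxx oppr_eq0 (negPf one0).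
  - by exists (vec4 1 0 0 eps); rewrite ?label_diag0 // vec4_neq0 ?one0.
  exists (vec4 1 0 0 1); first by rewrite vec4_neq0 ?one0.
  have sE : sinv (vec4 1 0 0 1) = 4%:R.
    by rewrite /sinv quadf4 hermf4 cj0 !mul0r !mul1r !subr0 cj1 mulr1 divr1; ring.
  rewrite /label sE (negPf four_neq0) eqxx quadf4 mul1r mul0r subr0 (negPf one0).
  by rewrite sig_diag.
have [s0|s0] := eqVneq s 0.
  have [|c cE] := @norm_surj (-1); first by rewrite !cjE.
  by exists (vec4 0 1 c 0); rewrite ?label_anti0 ?s0 // vec4_neq0 ?one0 ?orbT.
have [->|s4] := eqVneq s 4%:R.
  exists (vec4 0 1 1 eps); first by rewrite vec4_neq0 ?one0 ?orbT.
  rewrite /label sinv_skew eqxx (negPf four_neq0) (negPf nsig_skew).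
  by rewrite quadf4 mul1r mul0r sub0r oppr_eq0 (negPf one0).
(* The witness (1, y, 0, x) has [quadf] equal to [x], of norm [s], and [y] is chosen so that [hermf]
   is [s] as well; the invariant is then s^2 / s. *)
have [x xE] := norm_surj sE.
have [|y yE] := @norm_surj (x + cj x - s).
  by rewrite !cjE sE (addrC (cj x)).
exists (vec4 1 y 0 x); first by rewrite vec4_neq0 ?one0.
have x0 : x != 0 by apply: contraNneq s0 => x0; rewrite -xE x0 mul0r.
have ss : sinv (vec4 1 y 0 x) = s.
  rewrite /sinv quadf4 hermf4 yE cj1 cj0 !mulr0 !mul1r !subr0 xE.
  by have -> : x + cj x - (x + cj x - s) = s by [ring]; rewrite expr2 mulfK.
by rewrite /label ss (negPf s0) (negPf s4) quadf4 mul1r mulr0 subr0 (negPf x0).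
Qed.

Lemma card_fix : #|[set s : F | cj s == s]| = q.
Proof.
have -> : [set s : F | cj s == s] = 0 |: [set s | s ^+ q.-1 == 1].
  apply/setP=> s; rewrite !inE; have [->|s0] := eqVneq s 0; first by rewrite cj0 eqxx.
  have q1 : q.-1.+1 = q by rewrite prednK // (ltn_trans _ q_gt2).
  by rewrite /= -[RHS](inj_eq (mulfI s0)) -exprS q1 mulr1.
rewrite cardsU1 inE (@card_unity _ q.+1); last by rewrite sqq1 mulnC.
have := q_gt2; case: (q) => [|[|n]] // _.
by rewrite /= expr0n /= eq_sym oner_neq0 add1n.
Qed.

Lemma card_labels : #|labels| = (q + 4)%N.
Proof.
have dis : [disjoint
    [set (None, true); (None, false); (Some 0, true); (Some (4%:R : F), true)]
    & [set (Some s, false) | s in [set s : F | cj s == s]]].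
  rewrite disjoint_sym; apply/pred0P => l /=; apply/negP => /andP[/imsetP[s _ ->]].
  by rewrite !inE /= !xpair_eqE !andbF.
rewrite /labels cardsU disjoint_setI0 // cards0 subn0 card_imset; last by move=> s t [].
rewrite card_fix addnC; congr (_ + _)%N.
rewrite -!setUA !cardsU1 cards1 !inE !xpair_eqE /= !andbT.
by rewrite (inj_eq Some_inj) (eq_sym 0) (negPf four_neq0).
Qed.

(** * Orbits on points *)

Definition rep (x : PG3 F) : 'cV[F]_4 := xchoose (existsP (valP x)).

Lemma rep_neq0 x : rep x != 0.
Proof. by have /andP[] := xchooseP (existsP (valP x)). Qed.

Lemma point_set_rep (x : PG3 F) : point_set x = line (rep x).
Proof. by have /andP[_ /eqP] := xchooseP (existsP (valP x)). Qed.

Lemma line_id (v : 'cV[F]_4) : v \in line v.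
Proof. by apply/imsetP; exists 1; rewrite ?scale1r. Qed.

Lemma lineZ l (v : 'cV[F]_4) : l != 0 -> line (l *: v) = line v.
Proof.
move=> l0; apply/setP=> w; apply/imsetP/imsetP => -[c _ ->].
  by exists (c * l); rewrite ?scalerA.
by exists (c / l); rewrite ?scalerA ?divfK.
Qed.

Lemma rep_line x v : point_set x = line v -> exists2 l, l != 0 & rep x = l *: v.
Proof.
rewrite point_set_rep => E; have := line_id (rep x); rewrite E.
move=> /imsetP[l _ rE]; exists l => //.
by have := rep_neq0 x; rewrite rE; apply: contraNneq => ->; rewrite scale0r.
Qed.

Lemma mem_points_of (P : pred 'cV[F]_4) x :
  reflect (exists2 l, l != 0 & P (l *: rep x)) (x \in points_of P).
Proof.
rewrite inE; apply: (iffP existsP) => [[v]|[l l0 Pl]].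
  rewrite point_set_rep => /and3P[/imsetP[l _ ->] v0 Pv]; exists l => //.
  by apply: contraNneq v0 => ->; rewrite scale0r.
exists (l *: rep x); rewrite Pl scaler_eq0 negb_or l0 rep_neq0 !andbT.
by rewrite point_set_rep; apply/imsetP; exists l.
Qed.

Lemma mem_points_of_hom (P : pred 'cV[F]_4) x :
    (forall l v, l != 0 -> P (l *: v) = P v) ->
  (x \in points_of P) = P (rep x).
Proof.
move=> PZ; apply/mem_points_of/idP => [[l l0]|]; first by rewrite PZ.
by exists 1; rewrite ?oner_neq0 ?scale1r.
Qed.

Lemma act_unit (A : 'M[F]_2) : A \in unitmx -> frob_mx q A *t A \in unitmx.
Proof.
move=> uA; have E : (frob_mx q A *t A) *m (frob_mx q (invmx A) *t invmx A) = 1%:M.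
  rewrite tensmx_mul -(frob_mxM p_prime q_def cardF) mulmxV //.
  by rewrite (frob_mx1 _ p_prime q_def) tens1mx1.
by have [] := mulmx1_unit E.
Qed.

(** The predicate [S] is left open so as to serve both [grpG] and [grpK]. *)
Lemma mem_orbit (S : pred 'M[F]_2) (x y : PG3 F) : {subset S <= unitmx} ->
  reflect (exists2 A, S A & exists2 l, l != 0 & rep y = l *: act A (rep x))
    (y \in orbit 'P [set projectivity g | g : {'GL_4[F]} &
       [exists A : 'M[F]_2, S A && (GLval g == frob_mx q A *t A)]] x).
Proof.
move=> uS; apply: (iffP imsetP).
  move=> [s /imsetP[g /[!inE]/existsP[A /andP[SA /eqP gA]] ->] ->].
  exists A => //; apply: rep_line.
  by rewrite projectivityE point_set_rep line_mulmx gA.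
move=> [A SA [l l0 E]]; have uA := act_unit (uS _ SA).
pose g : {'GL_4[F]} := FinRing.unit 'M[F]_4 uA.
exists (projectivity g).
  by apply: imset_f; rewrite inE; apply/existsP; exists A; apply/andP; split.
apply: val_inj; rewrite /= [RHS]projectivityE !point_set_rep E lineZ //.
by rewrite line_mulmx.
Qed.

Definition label_class (l : option F * bool) : {set PG3 F} :=
  [set x | label (rep x) == l].

Lemma orbitG x : orbit 'P (grpG q F) x = label_class (label (rep x)).
Proof.
apply/setP=> y; rewrite [RHS]inE eq_sym.
have uS : {subset (fun A : 'M[F]_2 => A \in unitmx) <= unitmx} by [].
have lP := labelP (rep_neq0 x) (rep_neq0 y).
by apply/(mem_orbit x y uS)/eqP => E; apply/lP.
Qed.

Lemma pt_ex v : v != 0 -> exists x, label (rep x) = label v.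
Proof.
move=> v0; have lv : is_point (line v) by apply/existsP; exists v; rewrite v0 eqxx.
have [l l0 E] := @rep_line (Point lv) v erefl; exists (Point lv).
by apply/esym/label_eqv; rewrite E; apply: eqv_scale.
Qed.

Lemma orbitsG : orbits (grpG q F) [set: PG3 F] = label_class @: labels.
Proof.
apply/setP=> X; apply/imsetP/imsetP => [[x _ ->]|[l /label_onto[v v0 <-] ->]].
  by exists (label (rep x)); rewrite ?label_in ?orbitG.
by have [y <-] := pt_ex v0; exists y; rewrite ?orbitG.
Qed.

Lemma label_class_inj : {in labels &, injective label_class}.
Proof.
move=> k l /label_onto[v v0 <-] _; have [x <-] := pt_ex v0.
by move=> /setP/(_ x); rewrite !inE eqxx => /esym/eqP.
Qed.

Lemma tperm_mxE (v : 'cV[F]_4) : tperm_mx 1 2%:R *m v =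
  vec4 (v 0 0) (v 2%:R 0) (v 1 0) (v 3%:R 0).
Proof.
rewrite [LHS]vec4_eta -row_permE; congr vec4; rewrite !mxE ?tpermL ?tpermR //.
  by rewrite tpermD.
by rewrite tpermD.
Qed.

(** The swap transposes the matrix of the form, which keeps [quadf] and [hermf] and sends Hermitian
    matrices to Hermitian ones. *)
Lemma label_swap v : label (tperm_mx 1 2%:R *m v) = label v.
Proof.
rewrite tperm_mxE; set w := vec4 _ _ _ _.
have wq : quadf w = quadf v by rewrite quadf4 /quadf; ring.
have wh : hermf w = hermf v by rewrite hermf4 hermfE; ring.
have ws : sig w = sig v.
  apply: eq_existsb => l; rewrite /herm vec4Z !vec4E !mxE.
  have sw (x y : F) : (cj x == y) = (cj y == x).
    by rewrite -(inj_eq (can_inj cjK)) cjK eq_sym.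
  by rewrite [cj (l * v 1 0) == _]sw.
by rewrite /label /sinv wq wh ws.
Qed.

Lemma label_iota x : label (rep (iota_proj F x)) = label (rep x).
Proof.
have [|l l0 ->] := @rep_line (iota_proj F x) (tperm_mx 1 2%:R *m rep x).
  by rewrite projectivityE point_set_rep line_mulmx.
by rewrite -[RHS]label_swap; apply/esym/label_eqv/eqv_scale.
Qed.

Lemma orbitG' x : orbit 'P (grpG' q F) x = orbit 'P (grpG q F) x.
Proof.
have [_ ->] := sdprod_grpG' p_prime q_def cardF.
apply/eqP; rewrite eqEsubset; apply/andP; split; last first.
  apply/subsetP=> y /imsetP[g gG ->]; apply: imset_f.
  by rewrite -[g]mulg1 mem_mulg // group1.
apply/subsetP=> y /imsetP[s /mulsgP[g i gG /cycleP[n ->] ->] ->].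
have : aperm x g \in orbit 'P (grpG q F) x by apply: imset_f.
rewrite orbitG !inE => /eqP <-; rewrite /= /aperm permM.
elim: n => [|n IH]; first by rewrite perm1.
by rewrite expgSr permM label_iota.
Qed.

Lemma orbits_G' : orbits (grpG q F) [set: PG3 F] = orbits (grpG' q F) [set: PG3 F].
Proof. by apply: eq_imset => x; rewrite orbitG'. Qed.

Lemma card_orbitsG : #|orbits (grpG q F) [set: PG3 F]| = (q + 4)%N.
Proof. by rewrite orbitsG card_in_imset ?card_labels //; exact: label_class_inj. Qed.

(** * Equations of the orbits *)

Lemma mem_Sigma x : (x \in Sigma q F) = sig (rep x).
Proof.
apply/esym; apply/sigP/idP => [[l l0 /and3P[/eqP h0 /eqP h1 /eqP h3]]|].
  apply/mem_points_of; exists l => //.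
  apply/existsP; exists ((l *: rep x) 0 0); apply/existsP; exists ((l *: rep x) 1 0).
  apply/existsP; exists ((l *: rep x) 3%:R 0).
  rewrite -[_ ^+ q]/(cj _) h0 -[(l *: rep x) 3%:R 0 ^+ q]/(cj _) h3 !eqxx /=.
  by rewrite -[_ ^+ q]/(cj _) h1 -vec4_eta.
move=> /mem_points_of[l l0 /existsP[a /existsP[b /existsP[c]]]].
move=> /and3P[/eqP aE /eqP cE /eqP lE]; exists l => //.
by rewrite lE /herm !vec4E; apply/and3P; split=> //; apply/eqP.
Qed.

Lemma mem_calO x : (x \in calO q F) = (label (rep x) == (None, true)).
Proof.
have -> : (label (rep x) == (None, true)) =
    (quadf (rep x) == 0) && (hermf (rep x) == 0).
  by rewrite /label; case: (quadf _ == 0); rewrite // xpair_eqE eqxx eqb_id.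
apply/mem_points_of/andP => [[l l0 lE]|[/eqP d0 /eqP h0]].
  have : quadf (l *: rep x) = 0 /\ hermf (l *: rep x) = 0.
    case/orP: lE => [/existsP[t /eqP->]|/eqP->]; rewrite quadf4 hermf4.
      rewrite exprS -[t ^+ q]/(cj t) !cjE; split; ring.
    by rewrite !cjE; split; ring.
  rewrite quadfZ hermfZ => -[/eqP + /eqP].
  by rewrite !mulf_eq0 cj_eq0 (negPf l0).
have [l l0 E] := calO_coord (rep_neq0 x) d0 h0; exists l => //.
case: E => [[t ->]|->]; last by rewrite eqxx orbT.
by apply/orP; left; apply/existsP; exists t; rewrite exprS.
Qed.

Lemma label_class_O : label_class (None, true) = calO q F.
Proof. by apply/setP=> x; rewrite inE mem_calO. Qed.

Lemma label_class_Q : label_class (None, false) = calQ F :\: calO q F.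
Proof.
apply/setP=> x; rewrite inE [RHS]inE mem_calO mem_points_of_hom /label; last first.
  by move=> l v l0; rewrite quadfZ mulf_eq0 expf_eq0 (negPf l0).
case: (quadf _ == 0); last by rewrite andbF.
by rewrite !xpair_eqE eqxx /= andbT; case: (hermf _ == 0).
Qed.

Lemma herm_quad v : herm v -> hermf v = 2%:R * quadf v /\ cj (quadf v) = quadf v.
Proof.
move=> /and3P[/eqP h0 /eqP h1 /eqP h3].
have h2 : cj (v 2%:R 0) = v 1 0 by rewrite -h1 cjK.
by rewrite hermfE /quadf !cjE h0 h1 h2 h3; split; ring.
Qed.

(** A Hermitian multiple has h = 2d with d in F_q, and s is not changed by scalars. *)
Lemma sig_sinv v : sig v -> quadf v != 0 -> sinv v = 4%:R.
Proof.
move=> /sigP[l l0 /herm_quad]; rewrite quadfZ hermfZ => -[h d] d0.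
have cl0 : cj l != 0 by rewrite cj_eq0.
have cd0 : cj (quadf v) != 0 by rewrite cj_eq0.
have -> : sinv v =
    (l * cj l * hermf v) ^+ 2 / (l ^+ 2 * quadf v * cj (l ^+ 2 * quadf v)).
  rewrite /sinv; move: (hermf v) (quadf v) d0 cd0 => a b b0 cb0.
  by rewrite !cjE; field; rewrite l0 cl0 b0 cb0.
by rewrite h d; field; rewrite l0 d0.
Qed.

Lemma label_class_Sigma : label_class (Some 4%:R, true) = Sigma q F :\: calO q F.
Proof.
apply/setP=> x; rewrite [RHS]inE inE mem_calO mem_Sigma.
rewrite /label; have [d0|d0] := eqVneq (quadf (rep x)) 0.
  rewrite !xpair_eqE eqxx eqb_id /=; apply/esym/negP => /andP[h0].
  move=> /sigP[l l0 /herm_quad[]]; rewrite quadfZ hermfZ d0 !mulr0 => /eqP.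
  by rewrite !mulf_eq0 cj_eq0 (negPf l0) (negPf h0).
rewrite !xpair_eqE /= (inj_eq Some_inj); apply/andP/idP => [[/eqP ->]|sv].
  by rewrite (negPf four_neq0) eqxx => /eqP.
by rewrite (sig_sinv sv d0) eqxx (negPf four_neq0) sv.
Qed.

Definition V_pair (g g' : F) := V_gamma q g :|: V_gamma q g'.

(** The equations h = g d^((q+1)/2) and h = -g d^((q+1)/2) together say h^2 = g^2 d^(q+1), and
    d^(q+1) is the norm of d. *)
Lemma mem_V_pair (g : F) x : (x \in V_pair g (- g)) =
  (hermf (rep x) ^+ 2 == g ^+ 2 * (quadf (rep x) * cj (quadf (rep x)))).
Proof.
have half : (q.+1./2 * 2)%N = q.+1.
  by rewrite muln2 -[RHS](odd_double_half q.+1) /= q_odd.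
have hom (c l : F) v : l != 0 -> (hermf (l *: v) - c * quadf (l *: v) ^+ q.+1./2 == 0)
    = (hermf v - c * quadf v ^+ q.+1./2 == 0).
  move=> l0; rewrite hermfZ quadfZ exprMn -exprM mulnC half normE mulrCA -mulrBr.
  by rewrite mulf_eq0 expf_eq0 (negPf l0) andbF.
rewrite inE !mem_points_of_hom; try by move=> *; apply: hom.
rewrite mulNr opprK subr_eq0 addr_eq0 -eqf_sqr exprMn -exprM half normE //.
Qed.

(** Off the quadric the pair of equations is [sinv] = s; on the quadric it forces h = 0, and those
    points are exactly O. *)
Lemma label_class_V (s g : F) : s = g ^+ 2 -> s != 0 -> s != 4%:R ->
  label_class (Some s, false) = V_pair g (- g) :\: calO q F.
Proof.
move=> sE s0 s4; apply/setP=> x; rewrite [RHS]inE mem_V_pair inE mem_calO -sE /label.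
have [d0|d0] := eqVneq (quadf (rep x)) 0.
  rewrite d0 mul0r mulr0 sqrf_eq0 !xpair_eqE eqxx eqb_id /=.
  by case: (hermf _ == 0).
rewrite !xpair_eqE /= (inj_eq Some_inj).
rewrite -sinv_eqE //; case: eqP => //= ->.
by rewrite (negPf s0) (negPf s4).
Qed.

Lemma label_class_V4 (g : F) : g ^+ 2 = 4%:R ->
  label_class (Some 4%:R, false) = V_pair g (- g) :\: Sigma q F.
Proof.
move=> sE; apply/setP=> x; rewrite [RHS]inE mem_V_pair inE sE /label.
rewrite mem_Sigma.
have [d0|d0] := eqVneq (quadf (rep x)) 0.
  rewrite d0 mul0r mulr0 sqrf_eq0 !xpair_eqE /=.
  apply/esym/negP => /andP[/negP ns /eqP h0].
  (* O lies in Sigma, so removing Sigma removes the points on the quadric too. *)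
  apply: ns; have [l l0 E] := calO_coord (rep_neq0 x) d0 h0; apply/sigP; exists l => //.
  by case: E => [[t ->]|->]; rewrite /herm !vec4E !cjE ?(mulrC t) !eqxx.
rewrite !xpair_eqE /= (inj_eq Some_inj).
rewrite -sinv_eqE //; case: eqP => [->|]; last by rewrite andbF.
by rewrite (negPf four_neq0) eqbF_neg andbT.
Qed.

(** The exponent is half the order of [xi], so [xi ^+ (a + b)] is -1. Hence the indices j, q + 1 -
    j, and likewise k, q - 1 - k, have opposite gamma. *)
Lemma xi_half (a b : nat) : (a + b = q.+1 * (q.-1)./2)%N ->
  xi ^+ b + xi ^- b = - (xi ^+ a + xi ^- a).
Proof.
move=> ab; have : xi ^+ (a + b) = -1.
  have q1 : (q.-1./2 * 2)%N = q.-1.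
    rewrite muln2 -[RHS](odd_double_half q.-1); have := q_odd; have := q_gt2.
    by case: (q) => //= n _ /negPf->.
  have r0 : (0 < q.-1./2)%N by have := q_gt2; move: q1; lia.
  have : (xi ^+ (a + b)) ^+ 2 = 1.
    by rewrite -exprM ab -mulnA q1 -sqq1 (prim_expr_order xi_prim).
  move/eqP; rewrite sqrf_eq1 => /orP[|/eqP//].
  rewrite -(prim_order_dvd xi_prim) sqq1 ab => /dvdn_leq.
  by rewrite -{1 2}q1 => /(_ ltac:(nia)); nia.
rewrite exprD => E; have a0 : xi ^+ a != 0 by rewrite expf_neq0 ?xi_neq0.
have b0 : xi ^+ b != 0 by rewrite expf_neq0 ?xi_neq0.
have bE : xi ^+ b = - (xi ^+ a)^-1 by apply: (mulfI a0); rewrite E mulrN mulfV.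
by rewrite bE invrN invrK opprD addrC.
Qed.

Lemma calS_pair j : (1 <= j <= (q - 1) %/ 2)%N ->
  calS q xi j :|: calS q xi (q.+1 - j)
  = V_pair (xi ^+ (j * q.-1./2) + xi ^- (j * q.-1./2))
           (- (xi ^+ (j * q.-1./2) + xi ^- (j * q.-1./2))).
Proof.
move=> jr; rewrite /calS /V_pair; congr (_ :|: V_gamma _ _).
by apply: xi_half; rewrite -mulnDl subnKC //; lia.
Qed.

Lemma calE_pair k : (k <= (q - 3) %/ 2)%N ->
  calE q xi k :|: calE q xi (q.-1 - k)
  = V_pair (xi ^+ (k * q.+1./2) + xi ^- (k * q.+1./2))
           (- (xi ^+ (k * q.+1./2) + xi ^- (k * q.+1./2))).
Proof.
move=> kr; rewrite /calE /V_pair; congr (_ :|: V_gamma _ _).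
apply: xi_half; rewrite -mulnDl subnKC; last lia.
have qE : q = (q./2).*2.+1 by rewrite -[LHS]odd_double_half q_odd.
by move: (q./2) qE => r ->; rewrite /= ?uphalf_double !doubleK; nia.
Qed.

(** * Orbits of K on the Hermitian surface *)

(* Inserting a suitable element of the stabiliser of [v] makes the            *)
(* determinant 1: square determinants are realised by scalars, nonsquare ones *)
(* by scalar multiples of [B].                                                *)
Lemma act_SL v w x B m : B \in unitmx -> ~~ is_sqr (\det B) -> m != 0 ->
  act B v = m *: v -> eqv w v -> eqv v x ->
  exists2 A, \det A = 1 & exists2 l, l != 0 & x = l *: act A w.
Proof.
move=> uB nsB m0 Bv [A1 uA1 [l1 l10 E1]] [A2 uA2 [l2 l20 E2]].
have dB : \det B != 0 by rewrite -unitfE -unitmxE.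
have dA1 : \det A1 != 0 by rewrite -unitfE -unitmxE.
have dA2 : \det A2 != 0 by rewrite -unitfE -unitmxE.
have stab d : d != 0 -> exists2 C, \det C = d & exists2 k, k != 0 & act C v = k *: v.
  move=> d0; have [/is_sqrP[a aE]|nd] := boolP (is_sqr d).
    have a0 : a != 0 by apply: contraNneq d0 => a0; rewrite aE a0 expr0n.
    exists (a *: 1%:M); first by rewrite detZ det1 mulr1.
    by exists (a * cj a); rewrite ?mulf_neq0 ?cj_eq0 // actZl act1.
  have /is_sqrP[a aE] : is_sqr (d / \det B) by rewrite nonsqrM ?is_sqrV.
  have a0 : a != 0.
    have : d / \det B != 0 by rewrite mulf_neq0 ?invr_eq0.
    by rewrite aE; apply: contraNneq => ->; rewrite expr0n.
  exists (a *: B); first by rewrite detZ -aE divfK.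
  exists (a * cj a * m); first by rewrite !mulf_neq0 ?cj_eq0.
  by rewrite actZl Bv scalerA.
have [|C CE [k k0 Cv]] := stab (\det A1 * \det A2)^-1.
  by rewrite invr_eq0 mulf_neq0.
exists (A2 *m C *m A1); first by rewrite !det_mulmx CE; field; rewrite dA1 dA2.
exists (l2 * k^-1 * l1); first by rewrite !mulf_neq0 ?invr_eq0.
have A1w : act A1 w = l1^-1 *: v by rewrite E1 scalerA mulVf ?scale1r.
rewrite E2 !actM A1w !actZ Cv actZ !scalerA.
by congr (_ *: _); field; rewrite k0 l10.
Qed.

Variable c : F.
Hypothesis cE : c * cj c = -1.

Let c_neq0 : c != 0.
Proof.
have := oner_neq0 F; apply: contraNneq => c0; move: cE.
by rewrite c0 mul0r => /esym/eqP; rewrite oppr_eq0.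
Qed.

Definition base (b : bool) : 'cV[F]_4 := if b then vec4 1 0 0 eps else vec4 0 1 c 0.

Lemma label_base b : label (base b) = (Some 0, b).
Proof. by case: b; rewrite /= ?label_diag0 ?label_anti0. Qed.

Lemma base_neq0 b : base b != 0.
Proof. by case: b; rewrite /= vec4_neq0 ?oner_neq0 ?orbT. Qed.

(** The matrix [[0, 1], [d, 0]] fixes the point when [d] has norm [eps ^+ 2], respectively when
    [cj d = c ^+ 2 * d]. In the first case - d is a nonsquare by [nonsqr_norm]; in the second, - d =
    y^2 would give cj y = c y up to sign, and taking norms would equate the norm of [y] with its
    opposite. *)
Lemma base_stab b : exists B, [/\ B \in unitmx, ~~ is_sqr (\det B) &
  exists2 m, m != 0 & act B (base b) = m *: base b].
Proof.
suff [d [nsd dE]] : exists d, ~~ is_sqr (- d) /\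
    exists2 m, m != 0 & act (mx2 0 1 d 0) (base b) = m *: base b.
  exists (mx2 0 1 d 0); split=> //; last by rewrite det_mx2 mul0r mul1r sub0r.
  rewrite unitmxE det_mx2 mul0r mul1r sub0r unitfE; apply: contraNneq nsd => ->.
  by apply/is_sqrP; exists 0; rewrite expr0n.
  case: b; rewrite /base.
    have [|d dE] := @norm_surj (eps ^+ 2); first by rewrite cjX epsE sqrrN.
    exists d; split.
      apply/is_sqrP => -[y yE]; have /eqP[] := nonsqr_norm y.
      by rewrite -yE cjN mulrNN.
    exists eps => //; rewrite actE vec4Z /sesq_form !vec4E !cjE.
    by congr vec4; first [ring | rewrite -[RHS]expr2 -dE; ring].
  have [|d d0 dE] := @hilbert90 (c ^+ 2).
    by transitivity ((c * cj c) ^+ 2); [rewrite cjX; ring | rewrite cE sqrrN expr1n].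
  exists d; split.
    apply/is_sqrP => -[y yE].
    have : cj y ^+ 2 = (c * y) ^+ 2 by rewrite -cjX exprMn -yE cjN dE mulrN.
    have n0 : y * cj y != 0.
      rewrite mulf_neq0 ?cj_eq0 //; apply: contraNneq d0 => y0;
      by rewrite -oppr_eq0 yE y0 expr0n.
    have gen z : z = c * y \/ z = - (c * y) -> z * cj z = - (y * cj y).
      by case=> ->; rewrite ?cjN ?mulrNN cjM mulrACA cE mulN1r.
    move/eqP; rewrite eqf_sqr => E; move/eqP: n0; apply; apply: eq_opp0.
    rewrite -[RHS](gen (cj y)) ?cjK; first exact: mulrC.
    by case/orP: E => /eqP; [left | right].
  exists (c * d); first by rewrite mulf_neq0.
  rewrite actE vec4Z /sesq_form !vec4E !cjE dE; congr vec4; ring.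
Qed.

Lemma orbitK x b : label (rep x) = (Some 0, b) ->
  orbit 'P (grpK q F) x = label_class (Some 0, b).
Proof.
move=> xb; apply/setP=> y; rewrite [RHS]inE.
have uS : {subset (fun A : 'M[F]_2 => \det A == 1) <= unitmx}.
  by move=> A /eqP dA; rewrite unitmxE dA unitr1.
have eqb z : label (rep z) = (Some 0, b) -> eqv (rep z) (base b).
  by move=> zb; apply/labelP; rewrite ?rep_neq0 ?base_neq0 ?label_base.
apply/(mem_orbit x y uS)/eqP => [[A /uS uA [l l0 yE]]|yb].
  by rewrite -xb; apply/esym/label_eqv; exists A => //; exists l.
have [B [uB nB [m m0 Bb]]] := base_stab b.
have [A dA yE] := act_SL uB nB m0 Bb (eqb x xb) (eqv_sym (eqb y yb)).
by exists A => //; apply/eqP.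
Qed.

Lemma mem_calHO x :
  (x \in calH q F :\: calO q F) = ((label (rep x)).1 == Some 0).
Proof.
rewrite inE mem_calO mem_points_of_hom; last first.
  by move=> l v l0; rewrite hermfZ !mulf_eq0 cj_eq0 (negPf l0).
rewrite /label; have [d0|d0] := eqVneq (quadf (rep x)) 0.
  by rewrite xpair_eqE eqxx eqb_id andNb.
have dd0 : quadf (rep x) * cj (quadf (rep x)) != 0 by rewrite mulf_neq0 ?cj_eq0.
rewrite xpair_eqE /= (inj_eq Some_inj) /sinv mulf_eq0 sqrf_eq0 invr_eq0.
by rewrite (negPf dd0) orbF.
Qed.

Lemma orbitsK : orbits (grpK q F) (calH q F :\: calO q F)
  = [set label_class (Some 0, true); label_class (Some 0, false)].
Proof.
apply/setP=> X; rewrite !inE; apply/imsetP/orP => [[x]|].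
  rewrite mem_calHO; case E: (label (rep x)) => [s b] /eqP s0 ->.
  rewrite (@orbitK x b) ?E ?s0 //; last by rewrite -s0.
  by case: b {E s0}; [left | right].
have main b : exists2 x, x \in calH q F :\: calO q F &
    label_class (Some 0, b) = orbit 'P (grpK q F) x.
  have [x xb] := pt_ex (base_neq0 b); rewrite label_base in xb.
  by exists x; [rewrite mem_calHO xb | rewrite (orbitK xb)].
by case=> /eqP->; apply: main.
Qed.

(** * Sizes of the orbits of K *)

Definition SL2 : {set 'M[F]_2} := [set A | \det A == 1].

Lemma card_unitmx2 : #|[set A : 'M[F]_2 | A \in unitmx]| = #|'GL_2[F]|.
Proof.
rewrite -(card_imset _ (val_inj : injective (val : {'GL_2[F]} -> 'M[F]_2))).
apply: eq_card => A; rewrite inE; apply/idP/imsetP => [uA|[g _ ->]].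
  by exists (FinRing.unit 'M[F]_2 uA).
exact: (GL_unitmx g).
Qed.

(** Each invertible matrix is uniquely diag(d, 1) times a matrix of determinant 1. *)
Lemma card_SL2 : #|SL2| = (q ^ 2 * (q ^ 4 - 1))%N.
Proof.
have q2 : (0 < (q ^ 2).-1)%N by have := q_gt2; nia.
pose f (dA : F * 'M[F]_2) := mx2 dA.1 0 0 1 *m dA.2.
have f_inj : {in setX [set~ 0] SL2 &, injective f}.
  move=> [d A] [d' A']; rewrite !in_setX !inE /=.
  move=> /andP[d0 /eqP dA] /andP[d'0 /eqP dA'] E.
  have dd : d = d'.
    have := congr1 determinant E.
    by rewrite /f !det_mulmx !det_mx2 dA dA' /= !mulr1 mul0r !subr0.
  congr (_, _) => //; move: E; rewrite /f /= dd.
  have um : mx2 d' 0 0 1 \in unitmx by rewrite unitmxE det_mx2 mulr1 mul0r subr0 unitfE.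
  by move=> /(congr1 (mulmx (invmx (mx2 d' 0 0 1)))); rewrite !mulKmx.
have fE : f @: setX [set~ 0] SL2 = [set A : 'M[F]_2 | A \in unitmx].
  apply/setP=> A; rewrite inE; apply/imsetP/idP.
    move=> [[d B]]; rewrite in_setX !inE /= => /andP[d0 /eqP dB] ->.
    by rewrite unitmxE /f det_mulmx det_mx2 dB /= !mulr1 mul0r subr0 unitfE.
  rewrite unitmxE unitfE => dA; exists (\det A, mx2 (\det A)^-1 0 0 1 *m A).
    by rewrite !inE dA /= det_mulmx det_mx2 mulr1 mul0r subr0 mulVf.
  rewrite /f /= mulmxA mulmx2 !mul0r !mulr0 !mul1r !addr0 !add0r mulfV //.
  rewrite -[LHS]mul1mx; congr (_ *m _); rewrite [LHS]mx2_eta !mxE //.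
have := card_in_imset f_inj; rewrite fE card_unitmx2 cardsX cardsC1 cardF.
rewrite card_GL_2 cardF => E.
apply/eqP; rewrite -(eqn_pmul2l q2) -E (expnM q 2 2) (subn_sqr _ 1) subn1 addn1.
by rewrite mulnCA -mulnn !mulnA.
Qed.

Definition pt (x0 : PG3 F) v : PG3 F := insubd x0 (line v).

Lemma pt_line x0 v : v != 0 -> point_set (pt x0 v) = line v.
Proof.
move=> v0; rewrite /pt (insubdK x0) //.
by apply/existsP; exists v; rewrite v0 eqxx.
Qed.

Definition stabSL (v : 'cV[F]_4) : {set 'M[F]_2} :=
  [set A in SL2 | [exists l, act A v == l *: v]].

Lemma SL2_unit A : A \in SL2 -> A \in unitmx.
Proof. by rewrite inE unitmxE => /eqP->; rewrite unitr1. Qed.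

Lemma act_neq0 A v : A \in unitmx -> v != 0 -> act A v != 0.
Proof.
move=> uA; apply: contraNneq => E; rewrite -(act1 v) -(mulVmx uA) actM E.
by rewrite /kron_act mulmx0.
Qed.

(** Orbit-stabiliser for matrices: [f] sends [A] to the image of the base point, and each of its
    fibres is a left coset of [stabSL]. *)
Lemma card_label_class b :
  (#|label_class (Some 0%R, b)| * #|stabSL (base b)|)%N = #|SL2|.
Proof.
have [x0 x0b] := pt_ex (base_neq0 b); rewrite label_base in x0b.
have v0 := base_neq0 b; set v := base b in v0 *.
pose f A := pt x0 (act A v).
have fE A : A \in SL2 -> point_set (f A) = line (act A v).
  by move=> /SL2_unit uA; rewrite pt_line // act_neq0.
have fC A : A \in SL2 -> f A \in label_class (Some 0, b).
  move=> AS; have [l l0 rE] := rep_line (fE A AS).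
  rewrite inE -(label_base b); apply/eqP/esym/label_eqv; exists A.
    exact: SL2_unit.
  by exists l.
have fiber y : y \in label_class (Some 0, b) ->
    #|[set A in SL2 | f A == y]| = #|stabSL v|.
  rewrite inE => /eqP yb; have [B [uB nB [m m0 Bb]]] := base_stab b.
  have ey : eqv v (rep y) by apply/labelP; rewrite ?rep_neq0 ?label_base.
  have [A0 dA0 [l l0 yE]] := act_SL uB nB m0 Bb (eqv_refl v) ey.
  have A0S : A0 \in SL2 by rewrite inE dA0.
  have uA0 := SL2_unit A0S.
  have inj : injective (mulmx A0 : 'M[F]_2 -> 'M[F]_2) by apply: can_inj (mulKmx uA0).
  rewrite -[RHS](card_imset _ inj); apply: eq_card => A; rewrite [LHS]inE.
  apply/andP/imsetP => [[AS /eqP fA]|[C]].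
    have dA : \det A == 1 by rewrite inE in AS.
    exists (invmx A0 *m A); last by rewrite mulKVmx.
    rewrite !inE det_mulmx det_inv dA0 invr1 mul1r dA /=.
    have := line_id (act A v); rewrite -fE // fA point_set_rep.
    move=> /imsetP[k _ E]; apply/existsP; exists (k * l); apply/eqP.
    by rewrite actM E yE !actZ -actM mulVmx // act1 scalerA.
  rewrite !inE => /andP[/eqP dC /existsP[k /eqP kE]] ->.
  have AS : A0 *m C \in SL2 by rewrite inE det_mulmx dA0 dC mulr1.
  have uC : C \in unitmx by rewrite unitmxE dC unitr1.
  rewrite det_mulmx dA0 dC mulr1; split=> //; apply/eqP; apply: val_inj.
  have k0 : k != 0.
    by have := act_neq0 uC v0; rewrite kE; apply: contraNneq => ->; rewrite scale0r.
  by rewrite /= fE // point_set_rep yE lineZ // actM kE actZ lineZ.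
rewrite -[RHS]sum1_card (partition_big f (mem (label_class (Some 0, b)))) //=.
rewrite -sum_nat_const; apply: eq_bigr => y yC; rewrite -(fiber y yC).
by rewrite -sum1_card; apply: eq_bigl => A; rewrite !inE.
Qed.

Lemma mx2_inj (a b d d' x y z w : F) : mx2 a b d d' = mx2 x y z w ->
  [/\ a = x, b = y, d = z & d' = w].
Proof.
move=> E; split.
- by have := congr1 (fun M : 'M_2 => M 0 0) E; rewrite !mxE.
- by have := congr1 (fun M : 'M_2 => M 0 1) E; rewrite !mxE.
- by have := congr1 (fun M : 'M_2 => M 1 0) E; rewrite !mxE.
- by have := congr1 (fun M : 'M_2 => M 1 1) E; rewrite !mxE.
Qed.

Lemma vec4_inj (a b d d' x y z w : F) : vec4 a b d d' = vec4 x y z w ->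
  [/\ a = x, b = y, d = z & d' = w].
Proof.
move=> E; have := vec4E a b d d'; rewrite E.
by rewrite !vec4E => -[[[]]].
Qed.

Lemma stabSL_diag n v : (0 < n)%N ->
  (forall A, A \in stabSL v -> A 0 1 = 0 /\ A 1 0 = 0) ->
  (forall a, a != 0 -> (mx2 a 0 0 a^-1 \in stabSL v) = (a ^+ n == 1)) ->
  #|stabSL v| = #|[set a : F | a ^+ n == 1]|.
Proof.
move=> n0 offdiag diag; have a0 (a : F) : a ^+ n == 1 -> a != 0.
  by apply: contraTneq => ->; rewrite expr0n gtn_eqF // eq_sym oner_neq0.
rewrite -(@card_imset _ _ (fun a : F => mx2 a 0 0 a^-1)); last first.
  by move=> a a' /mx2_inj[].
apply: eq_card => A; apply/idP/imsetP => [AS|[a]]; last first.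
  by rewrite inE => an ->; rewrite diag ?a0.
have [A01 A10] := offdiag A AS.
have AE : A = mx2 (A 0 0) 0 0 (A 0 0)^-1.
  move: (AS); rewrite inE [A]mx2_eta A01 A10 inE det_mx2 mulr0 subr0.
  move=> /andP[/eqP dA _].
  rewrite !mxE /=; congr mx2; have Aa : A 0 0 != 0.
    by have := oner_neq0 F; apply: contraNneq => a00; rewrite -dA a00 mul0r.
  by apply: (mulfI Aa); rewrite dA mulfV.
exists (A 0 0) => //; rewrite inE -diag -?AE //.
move: AS; rewrite AE inE inE det_mx2 mulr0 subr0; case/andP=> dA _.
by move: dA; rewrite mxE /=; apply: contraTneq => ->; rewrite mul0r eq_sym oner_neq0.
Qed.

(** One off-diagonal equation, conjugated and compared with the other, makes [a * cj d] and
    [b * cj e'] vanish, so [A] is diagonal or antidiagonal. If antidiagonal, determinant 1 gives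
    [(eps * (b * cj b)) ^+ 2 = 1], but a skew element is neither 1 nor -1. *)
Lemma stabSL_base_true A : A \in stabSL (base true) -> A 0 1 = 0 /\ A 1 0 = 0.
Proof.
rewrite [A]mx2_eta inE [_ \in SL2]inE det_mx2 actE.
move: (A 0 0) (A 0 1) (A 1 0) (A 1 1) => a b d e'; rewrite !mxE /=.
move=> /andP[/eqP dA /existsP[l /eqP]].
rewrite /sesq_form !vec4E vec4Z !mul0r !mul1r !mulr0 !mulr1 !addr0 !add0r.
move=> /vec4_inj[e1 e2 e3 e4].
have t0 := two_neq0.
have e2' : a * cj d - eps * b * cj e' = 0.
  by rewrite -[RHS]cj0 -e2 !cjE epsE; ring.
have ad : a * cj d = 0.
  by apply: (mulfI t0); rewrite mulr0 -[RHS](addr0 0) -{1}e2' -e3; ring.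
have be : b * cj e' = 0.
  have : eps * (b * cj e') = 0 by rewrite -[RHS]e3 -[LHS]add0r -ad; ring.
  by move/eqP; rewrite mulf_eq0 (negPf eps0) => /eqP.
move/eqP: ad; move/eqP: be; rewrite !mulf_eq0 !cj_eq0.
have one0 := oner_neq0 F.
case/orP=> /eqP b0; case/orP=> /eqP a0 //; move: dA; rewrite b0 a0.
- by rewrite !mul0r subrr => /esym/eqP; rewrite (negPf one0).
- rewrite mul0r sub0r => bd; exfalso; rewrite a0 b0 in e1 e4.
  have : (eps * (b * cj b)) ^+ 2 = 1.
    have -> : eps * (b * cj b) = l by rewrite -e1 !cjE; ring.
    have lE : l * eps = d * cj d by rewrite -e4 !cjE; ring.
    transitivity ((b * d) * cj (b * d)).
      rewrite -[l]mulr1 -{1}e1.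
      transitivity (l * eps * (b * cj b)); last by rewrite lE !cjE; ring.
      by rewrite -e1 !cjE; ring.
    have -> : b * d = -1 by rewrite -bd opprK.
    by rewrite !cjE mulrNN mulr1.
  move/eqP; rewrite sqrf_eq1 => /orP[]/eqP E.
    have := congr1 cj E; rewrite cj1 !cjE epsE (mulrC (cj b)) mulNr E.
    by move=> /esym/eq_opp0/eqP; rewrite (negPf one0).
  have := congr1 cj E; rewrite !cjE epsE (mulrC (cj b)) mulNr E opprK.
  by move=> /eq_opp0/eqP; rewrite (negPf one0).
by rewrite mulr0 mulr0 subrr => /esym/eqP; rewrite (negPf one0).
Qed.

Lemma anti_skew x : x + c * cj x = 0 -> x = 0.
Proof.
move/eqP; rewrite addr_eq0 => /eqP xE; apply: norm_eq0; apply: eq_opp0.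
by rewrite {1 2}xE cjN mulrNN !cjM cjK mulrACA cE mulN1r (mulrC x).
Qed.

(** The vanishing entries have the shape of [anti_skew], so [A] is diagonal or antidiagonal. If
    antidiagonal, [cj d * b] has norm 1 and equals [c] up to sign, whose norm is -1. *)
Lemma stabSL_base_false A : A \in stabSL (base false) -> A 0 1 = 0 /\ A 1 0 = 0.
Proof.
rewrite [A]mx2_eta inE [_ \in SL2]inE det_mx2 actE.
move: (A 0 0) (A 0 1) (A 1 0) (A 1 1) => a b d e'; rewrite !mxE /=.
move=> /andP[/eqP dA /existsP[l /eqP]].
rewrite /sesq_form !vec4E vec4Z !mulr0 !mulr1 => /vec4_inj[e1 e2 e3 e4].
have ab : cj a * b = 0 by apply: anti_skew; rewrite -[RHS]e1 !cjE; ring.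
have de : cj d * e' = 0 by apply: anti_skew; rewrite -[RHS]e4 !cjE; ring.
have t0 := two_neq0; have one0 := oner_neq0 F.
move/eqP: ab; move/eqP: de; rewrite !mulf_eq0 !cj_eq0.
case/orP=> /eqP d0; case/orP=> /eqP a0 //; move: dA; rewrite d0 a0.
- by rewrite mul0r mulr0 subrr => /esym/eqP; rewrite (negPf one0).
- rewrite mul0r sub0r => bd; exfalso; rewrite a0 d0 in e2 e3.
  have bd1 : b * d = -1 by rewrite -bd opprK.
  have nx : (cj d * b) * cj (cj d * b) = 1.
    transitivity ((b * d) * cj (b * d)); first by rewrite !cjE; ring.
    by rewrite bd1 !cjE mulrNN mulr1.
  have : (cj d * b) ^+ 2 = c ^+ 2.
    have xE : cj d * b = c ^+ 2 * cj (cj d * b).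
      transitivity (l * c); first by rewrite -e3 cj0; ring.
      by rewrite -e2 !cjE; ring.
    by rewrite expr2 {2}xE mulrCA nx mulr1.
  move/eqP; rewrite eqf_sqr => /orP[]/eqP E; move: nx; rewrite E ?cjN ?mulrNN cE;
    by move=> /esym/eq_opp0/eqP; rewrite (negPf one0).
by rewrite !mulr0 mul0r subrr => /esym/eqP; rewrite (negPf one0).
Qed.

(** diag(a, a^-1) fixes the point exactly when the norm of [a] is its own inverse. *)
Lemma card_stab_true : #|stabSL (base true)| = (q.+1 * 2)%N.
Proof.
have q1 : (q.-1./2 * 2)%N = q.-1.
  have qE : q = (q./2).*2.+1 by rewrite -[LHS]odd_double_half q_odd.
  by move: (q./2) qE => r ->; rewrite /= doubleK muln2.
rewrite (@stabSL_diag (q.+1 * 2)) ?muln_gt0 //; last 2 first.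
- exact: stabSL_base_true.
- move=> a a0; have ca0 : cj a != 0 by rewrite cj_eq0.
  rewrite inE inE det_mx2 mulfV // mulr0 subr0 eqxx /= exprM -normE actE.
  rewrite /sesq_form !vec4E; apply/existsP/eqP => [[l /eqP]|E].
    rewrite vec4Z => /vec4_inj[e1 _ _ e4]; rewrite !cjE in e1 e4.
    have lE : l = a * cj a by rewrite -[LHS]mulr1 -e1; ring.
    have lE' : l = (a * cj a)^-1.
      by apply: (mulIf eps0); rewrite -e4; field; rewrite a0 ca0.
    by rewrite expr2 -{1}lE lE' mulVf // mulf_neq0.
  exists (a * cj a); apply/eqP; rewrite vec4Z !cjE; congr vec4; try ring.
  have E' : (a * cj a)^-1 = a * cj a.
    by apply: (mulfI (_ : a * cj a != 0)); rewrite ?mulfV ?mulf_neq0 // -expr2 E.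
  by rewrite -E'; field; rewrite a0 ca0.
by rewrite (@card_unity _ q.-1./2) // mulnAC -mulnA q1 sqq1.
Qed.

(** diag(a, a^-1) fixes the point exactly when [cj a / a] is its own inverse. *)
Lemma card_stab_false : #|stabSL (base false)| = (q.-1 * 2)%N.
Proof.
have q1 : (q.+1./2 * 2)%N = q.+1.
  by rewrite muln2 -[RHS](odd_double_half q.+1) /= q_odd.
have q2 := q_gt2; have qm : (0 < q.-1)%N by lia.
rewrite (@stabSL_diag (q.-1 * 2)) ?muln_gt0 ?qm //; last 2 first.
- exact: stabSL_base_false.
- move=> a a0; have ca0 : cj a != 0 by rewrite cj_eq0.
  have aE : a ^+ q.-1 = cj a / a.
    by apply: (mulIf a0); rewrite -exprSr prednK ?divfK //; lia.
  rewrite inE inE det_mx2 mulfV // mulr0 subr0 eqxx /= exprM aE actE.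
  rewrite /sesq_form !vec4E; apply/existsP/eqP => [[l /eqP]|E].
    rewrite vec4Z => /vec4_inj[_ e2 e3 _]; rewrite !cjE in e2 e3.
    have lE : l = cj a / a by rewrite -[LHS]mulr1 -e2; ring.
    have lE' : l = (cj a / a)^-1.
      by apply: (mulIf c_neq0); rewrite -e3; field; rewrite a0 ca0.
    by rewrite expr2 -{1}lE lE' mulVf // mulf_neq0 ?invr_eq0.
  exists (cj a / a); apply/eqP; rewrite vec4Z !cjE; congr vec4; try ring.
  have E' : (cj a / a)^-1 = cj a / a.
    by apply: (mulfI (_ : cj a / a != 0)); rewrite ?mulfV ?mulf_neq0 ?invr_eq0 //
      -expr2 E.
  by rewrite -E'; field; rewrite a0 ca0.
by rewrite (@card_unity _ q.+1./2) // mulnAC -mulnA q1 sqq1 mulnC.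
Qed.

Lemma card_SL2_factor : (q ^ 2 * (q ^ 4 - 1) = q ^ 2 * (q ^ 2 + 1) * (q - 1) * q.+1)%N.
Proof.
rewrite (expnM q 2 2) (subn_sqr _ 1) (subn_sqr q 1) !addn1 -!mulnA; congr (_ * _)%N.
by congr (_ * _)%N; rewrite mulnA mulnC.
Qed.

Lemma card_H1 : #|label_class (Some 0, true)| =
  ((q ^ 2 * (q ^ 2 + 1) * (q - 1)) %/ 2)%N.
Proof.
have := card_label_class true; rewrite card_stab_true card_SL2 card_SL2_factor.
rewrite (mulnC q.+1) mulnA => /eqP; rewrite eqn_pmul2r // => /eqP <-.
by rewrite mulnK.
Qed.

Lemma card_H2 : #|label_class (Some 0, false)| =
  ((q ^ 2 * (q ^ 2 + 1) * (q + 1)) %/ 2)%N.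
Proof.
have := card_label_class false; rewrite card_stab_false card_SL2 card_SL2_factor.
have q2 := q_gt2; have qm : (0 < q.-1)%N by lia.
rewrite (mulnC q.-1) mulnA subn1 [RHS]mulnAC => /eqP; rewrite eqn_pmul2r // => /eqP E.
by rewrite [(q + 1)%N]addn1 -E mulnK.
Qed.

(** * The values of gamma *)

(* [gamma ^+ 2], for [gamma] = w + w^-1 and [u] = w^2. *)
Definition trace_sq (u : F) := u + 2%:R + u^-1.

Lemma sq_trace (w : F) : w != 0 -> (w + w^-1) ^+ 2 = trace_sq (w ^+ 2).
Proof. by move=> w0; rewrite /trace_sq; field. Qed.

Lemma trace_sq_inv (u : F) : trace_sq u^-1 = trace_sq u.
Proof. by rewrite /trace_sq invrK; ring. Qed.

Lemma trace_sq_neq0 (u : F) : u != 0 -> u ^+ 2 != 1 -> trace_sq u != 0.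
Proof.
move=> u0; apply: contraNneq => E; suff -> : u = -1 by rewrite sqrrN expr1n.
apply/eqP; rewrite -addr_eq0 -sqrf_eq0; apply/eqP.
by transitivity (u * trace_sq u); [rewrite /trace_sq; field | rewrite E mulr0].
Qed.

Lemma trace_sq_neq4 (u : F) : u != 0 -> u ^+ 2 != 1 -> trace_sq u != 4%:R.
Proof.
move=> u0; apply: contraNneq => E; suff -> : u = 1 by rewrite expr1n.
apply/eqP; rewrite -subr_eq0 -sqrf_eq0; apply/eqP.
transitivity (u * (trace_sq u - 4%:R)); first by rewrite /trace_sq; field.
by rewrite E subrr mulr0.
Qed.

(** Inverting [u = z ^+ i] sends i to 2n - i and keeps [trace_sq]; i = 0 and i = n are excluded by
    [u ^+ 2 != 1]. *)
Lemma trace_sq_prim n (z u : F) : (n.*2).-primitive_root z -> u ^+ n.*2 = 1 ->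
  u ^+ 2 != 1 -> exists2 j, (0 < j < n)%N & trace_sq u = trace_sq (z ^+ j).
Proof.
move=> zp /(prim_rootP zp)[[i /= lt_i] ->] ui.
have i0 : i != 0%N by apply: contraNneq ui => ->; rewrite expr0 expr1n.
have i_n : i != n.
  by apply: contraNneq ui => ->; rewrite -exprM muln2 (prim_expr_order zp).
have [lt|gt] := ltnP i n; first by exists i; rewrite // lt0n i0.
exists (n.*2 - i)%N; first by move: lt_i gt i_n; rewrite -muln2; lia.
rewrite -trace_sq_inv; congr trace_sq.
have zi0 : z ^+ i != 0.
  by rewrite expf_neq0 // (prim_root_eq0 zp) -lt0n (prim_order_gt0 zp).
by apply: (mulfI zi0); rewrite mulfV // -exprD subnKC ?(prim_expr_order zp) // ltnW.
Qed.

Lemma q_half : (q.+1 = q.+1./2.*2)%N /\ (q.-1 = q.-1./2.*2)%N.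
Proof.
have qE : q = (q./2).*2.+1 by rewrite -[LHS]odd_double_half q_odd.
by move: (q./2) qE => r ->; rewrite /= ?uphalf_double !doubleK.
Qed.

Lemma prim_sqr_neq1 n (z : F) j : (n.*2).-primitive_root z -> (0 < j < n)%N ->
  (z ^+ j) ^+ 2 != 1.
Proof.
move=> zp /andP[j0 jn]; rewrite -exprM -(prim_order_dvd zp).
by apply/negP => /dvdn_leq; rewrite muln_gt0 j0 => /(_ isT); rewrite -muln2; lia.
Qed.

Lemma xi_primS : (q.+1./2.*2).-primitive_root (xi ^+ q.-1).
Proof. by have [<- _] := q_half; apply: xi_prim_dvd; rewrite -sqq1. Qed.

Lemma xi_primE : (q.-1./2.*2).-primitive_root (xi ^+ q.+1).
Proof. by have [_ <-] := q_half; apply: xi_prim_dvd; rewrite sqq1 mulnC. Qed.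

Lemma gammaS j : (xi ^+ (j * q.-1./2) + xi ^- (j * q.-1./2)) ^+ 2
  = trace_sq ((xi ^+ q.-1) ^+ j).
Proof.
rewrite sq_trace ?expf_neq0 ?xi_neq0 // -exprM -mulnA muln2.
by have [_ <-] := q_half; rewrite mulnC exprM.
Qed.

Lemma gammaE k : (xi ^+ (k * q.+1./2) + xi ^- (k * q.+1./2)) ^+ 2
  = trace_sq ((xi ^+ q.+1) ^+ k).
Proof.
rewrite sq_trace ?expf_neq0 ?xi_neq0 // -exprM -mulnA muln2.
by have [<- _] := q_half; rewrite mulnC exprM.
Qed.

Lemma label_class_S j : (0 < j < q.+1./2)%N ->
  label_class (Some (trace_sq ((xi ^+ q.-1) ^+ j)), false) = calSt q xi j.
Proof.
move=> jr; have jq := prim_sqr_neq1 xi_primS jr.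
have x0 : (xi ^+ q.-1) ^+ j != 0 by rewrite !expf_neq0 ?xi_neq0.
rewrite /calSt calS_pair.
  by apply: label_class_V; rewrite ?gammaS ?trace_sq_neq0 ?trace_sq_neq4.
by move: jr; have [+ _] := q_half; rewrite divn2; lia.
Qed.

Lemma label_class_E k : (0 < k < q.-1./2)%N ->
  label_class (Some (trace_sq ((xi ^+ q.+1) ^+ k)), false) = calEt q xi k.
Proof.
move=> kr; have kq := prim_sqr_neq1 xi_primE kr.
have x0 : (xi ^+ q.+1) ^+ k != 0 by rewrite !expf_neq0 ?xi_neq0.
rewrite /calEt calE_pair.
  by apply: label_class_V; rewrite ?gammaE ?trace_sq_neq0 ?trace_sq_neq4.
by move: kr; have [_ +] := q_half; rewrite divn2; lia.
Qed.

Lemma label_class_E0 : label_class (Some 4%:R, false) = calEt0 q xi.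
Proof.
have := calE_pair (leq0n ((q - 3) %/ 2)); rewrite subn0 => E; rewrite /calEt0 E.
by apply: label_class_V4; rewrite mul0n expr0 invr1; ring.
Qed.

Lemma trace_sq_fix u : u != 0 -> cj u = u \/ u * cj u = 1 ->
  cj (trace_sq u) = trace_sq u.
Proof.
move=> u0 [E|E]; rewrite /trace_sq !cjE ?E //.
by have -> : cj u = u^-1; [apply: (mulfI u0); rewrite E mulfV | rewrite invrK; ring].
Qed.

(** [u] is a root of X^2 - (s - 2) X + 1, whose discriminant s^2 - 4s lies in F_q and is thus a
    square. The conjugate of [u] is again a root, so it is [u] or [u^-1]. *)
Lemma trace_sq_ex s : cj s = s -> s != 0 -> s != 4%:R ->
  exists2 u, s = trace_sq u & u ^+ 2 != 1 /\ (u ^+ q.+1 = 1 \/ u ^+ q.-1 = 1).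
Proof.
move=> sE s0 s4; have t0 := two_neq0.
have [r rE] : exists r, r ^+ 2 = s ^+ 2 - 4%:R * s.
  by apply: fix_sqr; rewrite !cjE sE.
pose u := (s - 2%:R + r) / 2%:R.
have uE : u ^+ 2 - (s - 2%:R) * u + 1 = 0.
  have -> : u ^+ 2 - (s - 2%:R) * u + 1 = (r ^+ 2 - (s ^+ 2 - 4%:R * s)) / 4%:R.
    by rewrite /u; field; rewrite four_neq0 t0.
  by rewrite rE subrr mul0r.
have u0 : u != 0.
  apply: contraTneq isT => u0; move: uE; rewrite u0 mulr0 expr0n subr0 add0r.
  by move/eqP; rewrite oner_eq0.
have us : s = trace_sq u.
  apply: (mulIf u0); rewrite -[LHS](addr0) -uE /trace_sq; field.
  exact: u0.
exists u => //; split.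
  apply/negP; rewrite sqrf_eq1 => /orP[]/eqP u1; move: s0 s4; rewrite us u1 /trace_sq.
    by rewrite invr1 => _ /eqP[]; ring.
  by rewrite invrN invr1 => /eqP[]; ring.
have cu0 : cj u != 0 by rewrite cj_eq0.
have : (cj u - u) * (u * cj u - 1) = 0.
  transitivity (u * cj u * (trace_sq (cj u) - trace_sq u)).
    by rewrite /trace_sq; field; rewrite u0 cu0.
  have -> : trace_sq (cj u) = trace_sq u by rewrite -us -sE us /trace_sq !cjE.
  by rewrite subrr mulr0.
move/eqP; rewrite mulf_eq0 !subr_eq0 => /orP[]/eqP E; last by left; rewrite -normE.
by right; apply: cj_fix.
Qed.

Lemma gamma_ex s : cj s = s -> s != 0 -> s != 4%:R ->
  (exists2 j, (0 < j < q.+1./2)%N & s = trace_sq ((xi ^+ q.-1) ^+ j)) \/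
  (exists2 k, (0 < k < q.-1./2)%N & s = trace_sq ((xi ^+ q.+1) ^+ k)).
Proof.
move=> sE s0 s4; have [u -> [u2 [un|un]]] := trace_sq_ex sE s0 s4.
  by left; apply: trace_sq_prim xi_primS _ u2; have [<- _] := q_half.
by right; apply: trace_sq_prim xi_primE _ u2; have [_ <-] := q_half.
Qed.

(** * The list of orbits *)

Lemma orbitsG_explicit : orbits (grpG q F) [set: PG3 F] =
  [set calO q F; Sigma q F :\: calO q F; calQ F :\: calO q F;
     label_class (Some 0, true); label_class (Some 0, false)]
  :|: [set calSt q xi j | j : 'I_q & (1 <= j <= (q - 1) %/ 2)%N]
  :|: [set calEt q xi k | k : 'I_q & (1 <= k <= (q - 3) %/ 2)%N]
  :|: [set calEt0 q xi].
Proof.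
have q2 := q_gt2; have [hS hE] := q_half.
have rS j : (1 <= j <= (q - 1) %/ 2)%N = (0 < j < q.+1./2)%N.
  by move: hS; rewrite divn2; lia.
have rE k : (1 <= k <= (q - 3) %/ 2)%N = (0 < k < q.-1./2)%N.
  by move: hE; rewrite divn2; lia.
have fixl s : cj s = s -> label_class (Some s, false) \in label_class @: labels.
  move=> sE; apply: imset_f; rewrite inE; apply/orP; right.
  by apply/imsetP; exists s; rewrite ?inE ?sE.
have in_labels b : [/\ (None, b) \in labels, (Some 0, b) \in labels &
    (Some 4%:R, b) \in labels].
  have [t f] : (Some 0, false) \in labels /\ (Some 4%:R, false) \in labels.
    by split; rewrite inE imset_f ?orbT // inE ?cj0 ?cjn.
  by case: b; split=> //; rewrite !inE !eqxx ?orbT.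
rewrite orbitsG -label_class_Sigma -label_class_Q -label_class_O -label_class_E0.
apply/setP=> X; apply/imsetP/idP => [[l lL ->]|].
  (* These six labels are the orbits outside the two families; [gamma_ex] distributes the other
     values of s between the S_j and the E_k. *)
  have [|sp] := boolP (l \in [set (None, true); (None, false); (Some 0, true);
      (Some 0, false); (Some 4%:R, true); (Some 4%:R, false)]).
    move=> lS; rewrite !inE -!orbA in lS; move: lS.
    do 5!(case/orP=> [/eqP->|]; first by rewrite !in_setU !in_set1 !eqxx ?orbT).
    by move=> /eqP->; rewrite !in_setU !in_set1 !eqxx ?orbT.
  move: lL; rewrite inE => /orP[|/imsetP[s /[!inE]/eqP sE lE]].
    rewrite !inE => h; case/negP: sp; rewrite !inE.
    by case/orP: h => [/orP[/orP[->|->]|->]|->]; rewrite ?orbT.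
  have s0 : s != 0 by apply: contraNneq sp => s0; rewrite lE s0 !inE eqxx ?orbT.
  have s4 : s != 4%:R by apply: contraNneq sp => s4; rewrite lE s4 !inE eqxx ?orbT.
  rewrite lE; case: (gamma_ex sE s0 s4) => -[j jr ->].
    rewrite label_class_S //; apply/orP; left; apply/orP; left.
    apply/orP; right; have jq : (j < q)%N by move: jr; lia.
    by apply/imsetP; exists (Ordinal jq); rewrite // inE rS.
  rewrite label_class_E //; apply/orP; left; apply/orP; right.
  have jq : (j < q)%N by move: jr; lia.
  by apply/imsetP; exists (Ordinal jq); rewrite // inE rE.
have [nt z0t f4t] := in_labels true; have [nf z0f f4f] := in_labels false.
rewrite !in_setU -!orbA !in_set1.
do 5!(case/orP=> [/eqP->|]; first by eexists; last reflexivity).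
case/or3P=> [/imsetP[j]|/imsetP[k]|/eqP->]; last by eexists; last reflexivity.
  rewrite inE rS => jr ->; exists (Some (trace_sq ((xi ^+ q.-1) ^+ j)), false).
    have z0 : (xi ^+ q.-1) ^+ j != 0 by rewrite !expf_neq0 ?xi_neq0.
    rewrite inE imset_f ?orbT // inE; apply/eqP/trace_sq_fix => //; right.
    rewrite normE exprAC -[(xi ^+ _) ^+ _.+1]exprM mulnC -sqq1 (prim_expr_order xi_prim).
    exact: expr1n.
  by rewrite label_class_S.
rewrite inE rE => kr ->; exists (Some (trace_sq ((xi ^+ q.+1) ^+ k)), false).
  have z0 : (xi ^+ q.+1) ^+ k != 0 by rewrite !expf_neq0 ?xi_neq0.
  rewrite inE imset_f ?orbT // inE; apply/eqP/trace_sq_fix => //; left.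
  by rewrite cjX -normE !cjE mulrC.
by rewrite label_class_E.
Qed.

End Orbits.

Theorem proposition4p1 (p e q : nat) (p_prime : prime p) (e_gt0 : (0 < e)%N)
    (q_def : q = (p ^ e)%N) (q_odd : odd q)
    (F : finFieldType) (cardF : #|F| = (q ^ 2)%N)
    (xi : F) (xi_prim : (q ^ 2).-1.-primitive_root xi) :
  exists H1 H2 : {set PG3 F},
    [/\ orbits (grpK q F) (calH q F :\: calO q F) = [set H1; H2],
        #|H1| = ((q ^ 2 * (q ^ 2 + 1) * (q - 1)) %/ 2)%N,
        #|H2| = ((q ^ 2 * (q ^ 2 + 1) * (q + 1)) %/ 2)%N &
        [/\ orbits (grpG q F) [set: PG3 F] = orbits (grpG' q F) [set: PG3 F],
            #|orbits (grpG q F) [set: PG3 F]| = (q + 4)%N &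
            orbits (grpG q F) [set: PG3 F] =
              [set calO q F; Sigma q F :\: calO q F; calQ F :\: calO q F;
                   H1; H2]
              :|: [set calSt q xi j | j : 'I_q & (1 <= j <= (q - 1) %/ 2)%N]
              :|: [set calEt q xi k | k : 'I_q & (1 <= k <= (q - 3) %/ 2)%N]
              :|: [set calEt0 q xi]]].
Proof.
have [eps eps0 epsE] := skew_ex p_prime e_gt0 q_def q_odd cardF xi_prim.
have [|c cE] := @norm_surj p e q F xi p_prime e_gt0 q_def q_odd cardF xi_prim (-1).
  by rewrite (cjN p_prime e_gt0 q_def q_odd cardF xi_prim) cj1.
exists (label_class q eps (Some 0, true)), (label_class q eps (Some 0, false)).
split.
- exact: (orbitsK p_prime e_gt0 q_def q_odd cardF xi_prim eps0 epsE cE).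
- exact: (card_H1 p_prime e_gt0 q_def q_odd cardF xi_prim eps0 epsE cE).
- exact: (card_H2 p_prime e_gt0 q_def q_odd cardF xi_prim eps0 epsE cE).
split.
- exact: (orbits_G' p_prime e_gt0 q_def q_odd cardF xi_prim eps0 epsE).
- exact: (card_orbitsG p_prime e_gt0 q_def q_odd cardF xi_prim eps0 epsE).
exact: (orbitsG_explicit p_prime e_gt0 q_def q_odd cardF xi_prim eps0 epsE cE).
Qed.
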